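(* Let $\mathcal K'=(K',\dots)$ be any elementary extension of $\mathcal K$ and assume that both $\mathcal K$ and $\mathcal K'$ have the property that every definable subset of the field that is closed, bounded and discrete is finite. Let $X\subseteq K^m$ be a definable set having arbitrarily many germs at a given point $p_0\in X$. Let $X'\subseteq K'^m$ be defined by a formula defining $X$. If $|K^\times|$ is $\tau$-archimedean for some $\tau\in K^\times$ and $|K'^\times|$ is not $\tau$-archimedean, then the natural embedding of $(\mathcal C(X),\mathcal B)$ into $(\mathcal C(X'),\mathcal B')$, as structures in the language $\mathcal L_{\rm ring}\cup\{\mathcal B\}$, is not an elementary embedding.
   Context: Setting. $K$ is a field and $\mathcal O\subseteq K$ is either (ordered case) the unit interval $[-1,1]$ of a total order $\le$ making $K$ an ordered field, or (valued case) the valuation ring of a non-trivial valuation $v$ on $K$. $\mathcal K$ is an expansion of $(K,\mathcal O)$: a structure with universe $K$ in a language extending the ring language $\mathcal L_{\rm ring}=\{0,1,+,-,\times\}$ together with a unary predicate for $\mathcal O$; all notions below are applied likewise to $\mathcal K'$. ''Definable'' means first-order definable with parameters. $\mathcal O^\times$ is the set of non-zero $a\in\mathcal O$ with $a^{-1}\in\mathcal O$; $|x|$ is the class of $x\in K^\times$ in $K^\times/\mathcal O^\times$, $|0|=0$, and $|y|\le|x|$ iff $y\in x\mathcal O$; $|K^\times|=K^\times/\mathcal O^\times$. For $x\in K^m$, $\|x\|=\max_i|x_i|$; $K^m$ carries the topology given by the open balls for $\|\cdot\|$; ''bounded'' is with respect to $\|\cdot\|$. For definable $X\subseteq K^m$,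 $\mathcal C(X)$ is the ring (pointwise operations) of continuous definable functions $X\to K$; $\mathcal B=\{s\in\mathcal C(X): s(x)\in\mathcal O\ \forall x\in X\}$, and $\mathcal B'$ is the analogous subset of $\mathcal C(X')$. The natural embedding sends $f\in\mathcal C(X)$ to the function $X'\to K'$ defined in $\mathcal K'$ by a formula defining $f$ in $\mathcal K$. $|K^\times|$ is $\tau$-archimedean if for every $x\in K^\times$ there is $k\in\mathbb Z$ with $|\tau^k|\le|x|$. Germs. Let $p_0\in X$ and let $U$ be a definable neighborhood of $p_0$ in $X$. A function $s\in\mathcal C(U)$ vanishes on a germ at $p_0$ if $s(p_0)=0$ and $p_0$ is not an isolated point of the zero set $\{s=0\}$. Functions $s_1,\dots,s_k\in\mathcal C(U)$ vanish on separated germs at $p_0$ if there are $\delta_1,\dots,\delta_k\in\mathcal C(U\setminus\{p_0\})$ such that: (S1) the sets $S_i=\{s_i=0\}\setminus\{p_0\}$ are pairwise disjoint; (S2) each $s_i$ vanishes on a germ at $p_0$; (S3) for $i\ne j$, $\delta_i$ is constantly $1$ on $S_i$ and constantly $0$ on $S_j$; (S4) each $\delta_i$ is bounded on $U\setminus\{p_0\}$. $X$ has arbitrarily many germs at $p_0$ if for every positive integer $k$ there are a definable neighborhood $U$ of $p_0$ in $X$ and $k$ functions in $\mathcal C(U)$ that vanish on separated germs at $p_0$. *)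

(* Defs.v *)
From HB Require Import structures.
From mathcomp Require Import all_boot all_order all_algebra all_classical ring.

Set Implicit Arguments.
Unset Strict Implicit.
Unset Printing Implicit Defensive.
Import Order.TTheory GRing.Theory Num.Theory.
Local Open Scope classical_set_scope.
Local Open Scope ring_scope.

Record language := Language {
  fsym : Type; farity : fsym -> nat;
  rsym : Type; rarity : rsym -> nat }.

Record structure (L : language) (T : Type) := Structure {
  fint : forall f : fsym L, ('I_(farity f) -> T) -> T;
  rint : forall r : rsym L, ('I_(rarity r) -> T) -> Prop }.

Inductive term (L : language) : Type :=
| Var of nat
| App (f : fsym L) of ('I_(farity f) -> term L).
Arguments Var {L}.

(* Variables are de Bruijn indices: [All p] binds the variable 0 of [p]. *)
Inductive formula (L : language) : Type :=
| Bot
| Eq of term L & term L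
| Rel (r : rsym L) of ('I_(rarity r) -> term L)
| Imp of formula L & formula L
| All of formula L.
Arguments Bot {L}.

Definition scons T (a : T) (e : nat -> T) : nat -> T :=
  fun n => if n is k.+1 then e k else a.

Fixpoint eval L T (S : structure L T) (e : nat -> T) (t : term L) : T :=
  match t with
  | Var n => e n
  | App f a => fint S (fun i => eval S e (a i))
  end.

Fixpoint sat L T (S : structure L T) (e : nat -> T) (p : formula L) : Prop :=
  match p with
  | Bot => False
  | Eq t u => eval S e t = eval S e u
  | Rel r a => rint S (fun i => eval S e (a i))
  | Imp p q => sat S e p -> sat S e q
  | All p => forall a : T, sat S (scons a e) p
  end.

Definition elementary_embedding L T T' (S : structure L T)
    (S' : structure L T') (j : T -> T') : Prop :=
  forall (p : formula L) (e : nat -> T), sat S e p <-> sat S' (j \o e) p.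

Definition sum_language (L1 L2 : language) : language :=
  @Language (fsym L1 + fsym L2)
    (fun f => match f with inl f => farity f | inr f => farity f end)
    (rsym L1 + rsym L2)
    (fun r => match r with inl r => rarity r | inr r => rarity r end).

Definition sum_structure L1 L2 T (S1 : structure L1 T) (S2 : structure L2 T) :
    structure (sum_language L1 L2) T :=
  @Structure (sum_language L1 L2) T
    (fun f => match f with inl f => @fint _ _ S1 f | inr f => @fint _ _ S2 f end)
    (fun r => match r with inl r => @rint _ _ S1 r | inr r => @rint _ _ S2 r end).

(* The language of rings with one additional unary predicate; it serves both
   for [(K, O)] and for [(C(X), B)]. *)
Inductive ring_fsym := FZero | FOne | FAdd | FOpp | FMul.

Definition ring_farity (f : ring_fsym) : nat :=
  match f with FZero | FOne => 0 | FOpp => 1 | FAdd | FMul => 2 end.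

Definition ring_pred_language : language :=
  @Language ring_fsym ring_farity unit (fun=> 1%N).

Definition ring_pred_structure (R : pzRingType) (P : set R) :
    structure ring_pred_language R :=
  @Structure ring_pred_language R
    (fun f => match f return ('I_(ring_farity f) -> R) -> R with
     | FZero => fun=> 0
     | FOne => fun=> 1
     | FAdd => fun a => a ord0 + a ord_max
     | FOpp => fun a => - a ord0
     | FMul => fun a => a ord0 * a ord_max
     end)
    (fun r a => P (a ord0)).

Definition is_field_order (K : fieldType) (le : rel K) : Prop :=
  [/\ [/\ reflexive le, antisymmetric le, transitive le & total le],
      forall x y z, le x y -> le (x + z) (y + z) &
      forall x y, le 0 x -> le 0 y -> le 0 (x * y)].

Definition is_ordered_group (G : porderZmodType) : Prop :=
  total (<=%R : rel G) /\ forall x y z : G, x <= y -> x + z <= y + z.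

(* The value of [v] at [0] is irrelevant: it stands for infinity. *)
Definition is_valuation (K : fieldType) (G : porderZmodType) (v : K -> G) :
    Prop :=
  [/\ is_ordered_group G,
      forall x y, x != 0 -> y != 0 -> v (x * y) = v x + v y &
      forall x y, x != 0 -> y != 0 -> x + y != 0 ->
        Num.min (v x) (v y) <= v (x + y)].

Definition is_unit_interval (K : fieldType) (O : set K) : Prop :=
  exists2 le : rel K, is_field_order le & O = [set x | le (-1) x && le x 1].

Definition is_nontrivial_valuation_ring (K : fieldType) (O : set K) : Prop :=
  exists (G : porderZmodType) (v : K -> G),
    [/\ is_valuation v, exists2 x, x != 0 & v x != 0 &
        O = [set x | x = 0 \/ 0 <= v x]].

(* An expansion of [(K, O)] by the symbols of [E]. *)
Record field_expansion (E : language) := FieldExpansion {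
  univ :> fieldType;
  Oset : set univ;
  OsetP : is_unit_interval Oset \/ is_nontrivial_valuation_ring Oset;
  extra : structure E univ }.
Arguments Oset {E}.

Definition full_language (E : language) := sum_language ring_pred_language E.

Definition full E (M : field_expansion E) : structure (full_language E) M :=
  sum_structure (ring_pred_structure (Oset M)) (extra M).

(* [K'] is required to be an expansion of an ordered or valued field as well;
   this is no restriction on an elementary extension: the order is definable
   from [O], and "[O] is a proper valuation subring" is first-order and gives
   back a valuation with value group [K'^* / O'^*]. *)
Definition elementary_extension E (M M' : field_expansion E) (i : M -> M') :=
  elementary_embedding (full M) (full M') i.

(* The variables [0, ..., n-1] take the values [x], the following ones the
   values [e], which are the parameters. *)
Definition vcons T n (x : 'rV[T]_n) (e : nat -> T) : nat -> T :=
  fun k => if insub k is Some i then x ord0 i else e (k - n)%N.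

Section Definable.
Variables (E : language) (M : field_expansion E).

Definition defined_by n (p : formula (full_language E)) (e : nat -> M) :
    set 'rV[M]_n :=
  [set x | sat (full M) (vcons x e) p].

Definition definable n (X : set 'rV[M]_n) : Prop :=
  exists p e, X = defined_by p e.

Record definable_set n := DefinableSet {
  dset :> set 'rV[M]_n;
  dsetP : definable dset }.

Definition graph n (X : set 'rV[M]_n) (f : X -> M) : set 'rV[M]_(n + 1) :=
  [set row_mx (val x) (const_mx (f x)) | x in [set: X]].

Definition definable_fun n (X : set 'rV[M]_n) (f : X -> M) : Prop :=
  definable (graph f).

End Definable.

(* [X'] is the subset of [K'^n] defined by a formula defining [X]. *)
Definition same_formula E (M M' : field_expansion E) (i : M -> M') n
    (X : set 'rV[M]_n) (X' : set 'rV[M']_n) : Prop :=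
  exists p e, X = defined_by p e /\ X' = defined_by p (i \o e).

Section Topology.
Variables (E : language) (M : field_expansion E).

(* [|y| <= |x|] and [|y| < |x|]; the classes themselves are never formed. *)
Definition abs_le (y x : M) : Prop := exists2 a, Oset M a & y = x * a.
Definition abs_lt (y x : M) : Prop := abs_le y x /\ ~ abs_le x y.

(* [||x|| <= |r|] and [||x|| < |r|], where [||x||] is the maximum of the
   [|x_i|]; the latter is only used for [r != 0], hence is right for [n = 0]. *)
Definition norm_le n (x : 'rV[M]_n) (r : M) : Prop :=
  forall i, abs_le (x ord0 i) r.
Definition norm_lt n (x : 'rV[M]_n) (r : M) : Prop :=
  forall i, abs_lt (x ord0 i) r.

Definition ball n (x : 'rV[M]_n) (r : M) : set 'rV[M]_n :=
  [set y | norm_lt (y - x) r].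

Definition open_set n (A : set 'rV[M]_n) : Prop :=
  forall x, A x -> exists2 r, r != 0 & ball x r `<=` A.

Definition closed_set n (A : set 'rV[M]_n) : Prop := open_set (~` A).

Definition bounded n (A : set 'rV[M]_n) : Prop :=
  exists r, forall x, A x -> norm_le x r.

Definition isolated n (x : 'rV[M]_n) (A : set 'rV[M]_n) : Prop :=
  A x /\ exists2 r, r != 0 & A `&` ball x r `<=` [set x].

Definition discrete n (A : set 'rV[M]_n) : Prop :=
  forall x, A x -> isolated x A.

Definition neighborhood_in n (X : set 'rV[M]_n) (x : 'rV[M]_n)
    (U : set 'rV[M]_n) : Prop :=
  U `<=` X /\ exists2 r, r != 0 & X `&` ball x r `<=` U.

Definition continuous_fun n (X : set 'rV[M]_n) (f : X -> M) : Prop :=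
  forall (x : X) (eps : M), eps != 0 ->
    exists2 delta : M, delta != 0 &
      forall y : X, ball (val x) delta (val y) -> abs_lt (f y - f x) eps.

Definition cdf n (X : set 'rV[M]_n) : set (X -> M) :=
  [set f | continuous_fun f /\ definable_fun f].
Arguments cdf [n] X _.

Definition bounded_fun n (X : set 'rV[M]_n) (f : X -> M) : Prop :=
  exists r, forall x, abs_le (f x) r.

Definition closed_bounded_discrete_finite : Prop :=
  forall Y : set 'rV[M]_1, definable Y ->
    closed_set Y -> bounded Y -> discrete Y -> finite_set Y.

Definition archimedean (tau : M) : Prop :=
  forall x : M, x != 0 -> exists k : int, abs_le (tau ^ k) x.

Definition zero_set n (U : set 'rV[M]_n) (s : U -> M) : set 'rV[M]_n :=
  [set val x | x in [set x : U | s x = 0]].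

Definition vanishes_on_germ n (U : set 'rV[M]_n) (p0 : 'rV[M]_n)
    (s : U -> M) : Prop :=
  zero_set s p0 /\ ~ isolated p0 (zero_set s).

Definition separating_data n (U : set 'rV[M]_n) (p0 : 'rV[M]_n) (k : nat)
    (s : 'I_k -> U -> M) (delta : 'I_k -> (U `\ p0 : set _) -> M) : Prop :=
  let S i := zero_set (s i) `\ p0 in
  [/\ forall i j, i != j -> S i `&` S j = set0,
      forall i, vanishes_on_germ p0 (s i),
      forall i j, i != j ->
        (forall x, S i (val x) -> delta i x = 1) /\
        (forall x, S j (val x) -> delta i x = 0) &
      forall i, bounded_fun (delta i)].

Definition vanish_on_separated_germs n (U : set 'rV[M]_n) (p0 : 'rV[M]_n)
    (k : nat) (s : 'I_k -> U -> M) : Prop :=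
  exists2 delta : 'I_k -> (U `\ p0 : set _) -> M,
    forall i, cdf (U `\ p0) (delta i) & separating_data s delta.

Definition arbitrarily_many_germs n (X : set 'rV[M]_n) (p0 : 'rV[M]_n) :
    Prop :=
  forall k : nat, (0 < k)%N ->
    exists U : set 'rV[M]_n,
      [/\ definable U, neighborhood_in X p0 U &
          exists2 s : 'I_k -> U -> M,
            forall i, cdf U (s i) & vanish_on_separated_germs p0 s].

End Topology.
Arguments cdf {E M n} X _.

Definition Oset_axioms (K : fieldType) (O : set K) : Prop :=
  [/\ O 1, forall x, O x -> O (- x), forall x y, O x -> O y -> O (x * y),
      forall x, O x \/ O x^-1 &
      exists c t : K, [/\ c != 0, t != 0, O t, ~ O t^-1 &
        forall x y, O x -> O y -> O ((x + y) / c)]].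

Lemma unit_interval_axioms (K : fieldType) (O : set K) :
  is_unit_interval O -> Oset_axioms O.
Proof.
move=> [le [[rf an tr to] leD leM] ->].
have leB x y : le x y = le 0 (y - x).
  apply/idP/idP => [/(leD _ _ (- x))|/(leD _ _ x)]; first by rewrite subrr.
  by rewrite add0r subrK.
have leE x : [set x | le (-1) x && le x 1] x <-> le 0 (1 + x) /\ le 0 (1 - x).
  by rewrite /= (leB (-1)) (leB x) opprK addrC; split => /andP.
have lesq x : le 0 (x * x).
  have [|/(leD _ _ (- x))] := orP (to 0 x); first by move=> h; exact: leM.
  by rewrite subrr add0r -mulrNN => h; exact: leM.
have le01 : le 0 1 by rewrite -(mulr1 1).
have le0D x y : le 0 x -> le 0 y -> le 0 (x + y).
  by move=> hx hy; apply: tr hy _; have := leD _ _ y hx; rewrite add0r.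
have anti x : le 0 x -> le 0 (- x) -> x = 0.
  by move=> h h'; apply: an; rewrite h andbT leB sub0r.
have le0V x : le 0 x -> le 0 x^-1.
  move=> hx; have [->|x0] := eqVneq x 0; first by rewrite invr0.
  by rewrite -[x^-1]mul1r -[1](divff x0) -mulrA; apply: leM.
have n1 : ~ le 0 (- 1) by move=> /(anti _ le01)/eqP; rewrite oner_eq0.
have n2 : (2 : K) != 0.
  by apply/eqP => h; apply: n1; have -> : - 1 = 1 - 2 :> K by [ring]; rewrite h subr0; exact: le01.
have le02 : le 0 2 by have -> : 2 = 1 + 1 :> K by [ring]; exact: le0D.
have half x : le 0 (2 * x) -> le 0 x.
  by move=> h; have -> : x = 2^-1 * (2 * x) by [field]; apply: leM => //; exact: le0V.
split.
- by apply/leE; rewrite subrr; split=> //; exact: le0D.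
- by move=> x /leE[h1 h2]; apply/leE; rewrite opprK.
- move=> x y /leE[h1 h2] /leE[h3 h4]; apply/leE; split; apply: half.
    have -> : 2 * (1 + x * y) = (1 + x) * (1 + y) + (1 - x) * (1 - y) by ring.
    by apply: le0D; exact: leM.
  have -> : 2 * (1 - x * y) = (1 + x) * (1 - y) + (1 - x) * (1 + y) by ring.
  by apply: le0D; exact: leM.
- have pos x : le 0 x ->
      le 0 (1 + x) /\ le 0 (1 - x) \/ le 0 (1 + x^-1) /\ le 0 (1 - x^-1).
    move=> x0; case/orP: (to x 1) => [|x1]; [left|right]; rewrite -?(leB x 1).
      by split=> //; exact: le0D.
    split; first by apply: le0D => //; exact: le0V.
    have [x00|x00] := eqVneq x 0; first by rewrite x00 invr0 subr0.
    have -> : 1 - x^-1 = (x - 1) * x^-1 by field.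
    by apply: leM; [rewrite -leB|exact: le0V].
  move=> x; have [/pos[] h|] := orP (to 0 x); [by left; apply/leE|by right; apply/leE|].
  rewrite leB sub0r => /pos; rewrite invrN !opprK => -[] [h1 h2]; [left|right];
    by apply/leE.
- exists 2, 2^-1; split => //; rewrite ?invr_eq0 //.
  + apply/leE; split; first by apply: le0D => //; exact: le0V.
    by have -> : 1 - 2^-1 = 2^-1 :> K by [field]; exact: le0V.
  + by move=> /leE[_]; rewrite invrK; have -> : 1 - 2 = -1 :> K by ring.
  + move=> x y /leE[h1 h2] /leE[h3 h4]; apply/leE; split.
      have -> : 1 + (x + y) / 2 = ((1 + x) + (1 + y)) / 2 by field.
      by apply: leM; [exact: le0D|exact: le0V].
    have -> : 1 - (x + y) / 2 = ((1 - x) + (1 - y)) / 2 by field.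
    by apply: leM; [exact: le0D|exact: le0V].
Qed.

Lemma valuation_ring_axioms (K : fieldType) (O : set K) :
  is_nontrivial_valuation_ring O -> Oset_axioms O.
Proof.
move=> [G [v [[[to leD] vM vD] [x0 x0n vx0] ->]]].
have pm (g : G) : 0 <= g \/ 0 <= - g.
  case/orP: (to 0 g) => [|/(leD _ _ (- g))]; first by left.
  by rewrite subrr add0r; right.
have le0D (g h : G) : 0 <= g -> 0 <= h -> 0 <= g + h.
  by move=> /(leD _ _ h) + hh; rewrite add0r; exact: le_trans.
have anti (g : G) : 0 <= g -> 0 <= - g -> g = 0.
  move=> h /(leD _ _ g); rewrite add0r addNr => h'.
  by apply/eqP; rewrite eq_le h h'.
have v1 : v 1 = 0.
  by apply: (addrI (v 1)); rewrite -vM ?oner_neq0 // mulr1 addr0.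
have N1 : (-1 : K) != 0 by rewrite oppr_eq0 oner_neq0.
have vN1 : v (-1) = 0.
  have h : v (-1) + v (-1) = 0 by rewrite -vM // mulrNN mulr1.
  have h' : v (-1) = - v (-1) by apply/eqP; rewrite -subr_eq0 opprK h.
  by case: (pm (v (-1))) => h2; apply: anti => //; rewrite -?h' // h'.
have vV x : x != 0 -> v x^-1 = - v x.
  move=> x0'; apply/eqP; rewrite -addr_eq0 -vM ?invr_eq0 //.
  by rewrite mulVf // v1.
split=> /=.
- by right; rewrite v1.
- move=> x [->|h]; [by left; rewrite oppr0|].
  have [->|x0'] := eqVneq x 0; [by left; rewrite oppr0|right].
  by rewrite -mulN1r vM // vN1 add0r.
- move=> x y [->|hx]; [by left; rewrite mul0r|].
  move=> [->|hy]; [by left; rewrite mulr0|].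
  have [->|x0'] := eqVneq x 0; [by left; rewrite mul0r|].
  have [->|y0'] := eqVneq y 0; [by left; rewrite mulr0|right].
  by rewrite vM //; exact: le0D.
- move=> x; have [->|x0'] := eqVneq x 0; [by left; left|].
  by rewrite vV //; case: (pm (v x)) => h; [left|right]; right.
- have [t [tn vt vt']] : exists t, [/\ t != 0, v t != 0 & 0 <= v t].
    case: (pm (v x0)) => h; first by exists x0.
    by exists x0^-1; rewrite vV // invr_eq0 oppr_eq0.
  exists 1, t; split=> //; [exact: oner_neq0|by right| |].
    move=> [/eqP|]; first by rewrite invr_eq0 (negPf tn).
    by rewrite vV // => /(anti _ vt')/eqP; rewrite (negPf vt).
  move=> x y; rewrite divr1.
  have [->|x0'] := eqVneq x 0; [by rewrite add0r|].
  have [->|y0'] := eqVneq y 0; [by rewrite addr0|].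
  have [->|xy0] := eqVneq (x + y) 0; [by left|].
  move=> [/eqP|hx]; [by rewrite (negPf x0')|].
  move=> [/eqP|hy]; [by rewrite (negPf y0')|right].
  apply: le_trans (vD _ _ x0' y0' xy0).
  by rewrite minEle; case: ifP.
Qed.

Section Continuity.
Variables (E : language) (M : field_expansion E).
Local Notation O := (Oset M).

Lemma OsetA : Oset_axioms O.
Proof.
by case: (OsetP M) => [/unit_interval_axioms|/valuation_ring_axioms].
Qed.

Lemma abs_le_trans (x y z : M) : abs_le x y -> abs_le y z -> abs_le x z.
Proof.
have [_ _ OM _ _] := OsetA.
by move=> [a Oa ->] [b Ob ->]; exists (b * a); rewrite ?mulrA //; exact: OM.
Qed.

Lemma abs_lt_le_trans (x y z : M) : abs_lt x y -> abs_le y z -> abs_lt x z.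
Proof.
move=> [xy yx] yz; split; first exact: abs_le_trans yz.
by move=> zx; apply: yx; exact: abs_le_trans zx.
Qed.

Lemma abs_le_min (r s : M) : r != 0 -> s != 0 ->
  exists2 t, t != 0 & abs_le t r /\ abs_le t s.
Proof.
move=> r0 s0; have [O1 _ _ OV _] := OsetA.
have le_refl (x : M) : abs_le x x by exists 1; rewrite ?mulr1.
case: (OV (r / s)) => h; [exists r|exists s] => //; split => //.
  by exists (r / s) => //; field.
by exists (r / s)^-1 => //; field; rewrite r0 s0.
Qed.

Lemma abs_shrink (r : M) : r != 0 ->
  exists2 t, t != 0 & forall a, abs_le a t -> abs_lt a r.
Proof.
move=> r0; have [_ _ OM _ [_ [t [_ t0 Ot OtV _]]]] := OsetA.
exists (r * t) => [|a [u Ou ->]]; first exact: mulf_neq0.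
split; first by exists (t * u); rewrite ?mulrA //; exact: OM.
move=> [w Ow]; rewrite -!mulrA -{1}[r]mulr1 => /(mulfI r0) h; apply: OtV.
have -> : t^-1 = u * w by rewrite -[LHS]mulr1 h mulKf.
exact: OM.
Qed.

Lemma abs_sub (r : M) : r != 0 ->
  exists2 t, t != 0 &
    forall a b, abs_le a t -> abs_le b t -> abs_le (a - b) r.
Proof.
move=> r0; have [_ ON _ _ [c [_ [c0 _ _ _ OD]]]] := OsetA.
exists (r / c) => [|a b [u Ou ->] [w Ow ->]].
  by rewrite mulf_neq0 ?invr_eq0.
by exists ((u + - w) / c); [apply: OD => //; exact: ON|field].
Qed.

Lemma abs_scale (x r : M) : r != 0 ->
  exists2 t, t != 0 & forall a, abs_le a t -> abs_le (x * a) r.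
Proof.
move=> r0; have [->|x0] := eqVneq x 0.
  exists r => // a [u Ou ->]; have [_ _ _ OV _] := OsetA.
  have O0 : O 0 by case: (OV 0); rewrite ?invr0.
  by exists 0 => //; rewrite mul0r mulr0.
exists (r / x) => [|a [u Ou ->]]; first by rewrite mulf_neq0 ?invr_eq0.
by exists u => //; field.
Qed.

Lemma abs_leM (a b r : M) : abs_le a 1 -> abs_le b r -> abs_le (a * b) r.
Proof.
have [_ _ OM _ _] := OsetA.
move=> [u Ou ->] [w Ow ->]; exists (u * w); first exact: OM.
by rewrite mul1r mulrCA.
Qed.

Variables (n : nat) (X : set 'rV[M]_n).

Lemma ball_subset (x : 'rV[M]_n) (r s : M) :
  abs_le r s -> ball x r `<=` ball x s.
Proof. by move=> rs y xy i; exact: abs_lt_le_trans rs. Qed.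

Definition near_in (x : X) (P : X -> Prop) : Prop :=
  exists2 delta : M, delta != 0 & forall y : X, ball (val x) delta (val y) -> P y.

Lemma near_in2 (x : X) (P Q R : X -> Prop) : near_in x P -> near_in x Q ->
  (forall y, P y -> Q y -> R y) -> near_in x R.
Proof.
move=> [r r0 hr] [s s0 hs] PQR; have [t t0 [tr ts]] := abs_le_min r0 s0.
exists t => // y xy; apply: PQR; [apply: hr|apply: hs].
  exact: ball_subset tr _ xy.
exact: ball_subset ts _ xy.
Qed.

Lemma continuous_funP (f : X -> M) : continuous_fun f <->
  forall (x : X) (r : M), r != 0 -> near_in x (fun y => abs_le (f y - f x) r).
Proof.
split=> [cf x r r0|cf x r r0].
  by have [d d0 hd] := cf x r r0; exists d => // y /hd[].
have [s s0 hs] := abs_shrink r0.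
by have [d d0 hd] := cf x s s0; exists d => // y /hd /hs.
Qed.

Lemma continuous_cst (c : M) : continuous_fun (fun _ : X => c).
Proof.
have [O1 _ _ OV _] := OsetA.
apply/continuous_funP => x r r0; exists 1; first exact: oner_neq0.
move=> y _; rewrite subrr; exists 0; last by rewrite mulr0.
by case: (OV 0); rewrite ?invr0.
Qed.

Lemma continuous_sub (f g : X -> M) : continuous_fun f -> continuous_fun g ->
  continuous_fun (fun x => f x - g x).
Proof.
move=> /continuous_funP cf /continuous_funP cg; apply/continuous_funP => x r r0.
have [s s0 hs] := abs_sub r0; apply: near_in2 (cf x _ s0) (cg x _ s0) _ => y h k.
have -> : f y - g y - (f x - g x) = (f y - f x) - (g y - g x) by ring.
exact: hs.
Qed.

Lemma continuous_mul (f g : X -> M) : continuous_fun f -> continuous_fun g ->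
  continuous_fun (fun x => f x * g x).
Proof.
move=> /continuous_funP cf /continuous_funP cg; apply/continuous_funP => x r r0.
have [s s0 hs] := abs_sub r0; have [t t0 ht] := abs_sub s0.
have [u u0 hu] := abs_scale (- f x) t0; have [w w0 hw] := abs_scale (g x) t0.
have nf : near_in x (fun y => abs_le (f y - f x) 1 /\ abs_le (f y - f x) w).
  by apply: near_in2 (cf x _ (oner_neq0 M)) (cf x _ w0) _.
have ng : near_in x (fun y => abs_le (g y - g x) s /\ abs_le (g y - g x) u).
  by apply: near_in2 (cg x _ s0) (cg x _ u0) _.
apply: near_in2 nf ng _ => y [f1 fw] [gs gu].
have -> : f y * g y - f x * g x = (f y - f x) * (g y - g x)
    - (- f x * (g y - g x) - g x * (f y - f x)) by ring.
by apply: hs; [exact: abs_leM|apply: ht; [exact: hu|exact: hw]].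
Qed.

End Continuity.

Section Renaming.
Variable L : language.

Fixpoint trename (r : nat -> nat) (t : term L) : term L :=
  match t with
  | Var n => Var (r n)
  | App f a => App (fun i => trename r (a i))
  end.

Definition rshift_var (r : nat -> nat) (n : nat) : nat :=
  if n is k.+1 then (r k).+1 else 0.

Fixpoint rename (r : nat -> nat) (p : formula L) : formula L :=
  match p with
  | Bot => Bot
  | Eq t u => Eq (trename r t) (trename r u)
  | Rel s a => Rel (fun i => trename r (a i))
  | Imp p q => Imp (rename r p) (rename r q)
  | All p => All (rename (rshift_var r) p)
  end.

Variables (T : Type) (S : structure L T).

Lemma eval_rename r e t : eval S e (trename r t) = eval S (e \o r) t.
Proof. by elim: t => //= f a IH; congr fint; apply/funext => i; exact: IH. Qed.

Lemma sat_rename p : forall r e, sat S e (rename r p) <-> sat S (e \o r) p.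
Proof.
elim: p => //= [t u|s a|p IHp q IHq|p IHp] r e.
- by rewrite !eval_rename.
- by under eq_fun do rewrite eval_rename.
- by rewrite IHp IHq.
- have E a : scons a e \o rshift_var r = scons a (e \o r).
    by apply/funext; case.
  by split=> h a; move: (h a); rewrite IHp E.
Qed.

End Renaming.

Lemma vcons_lt T n (x : 'rV[T]_n) e (i : 'I_n) : vcons x e i = x ord0 i.
Proof. by rewrite /vcons valK. Qed.

Lemma vcons_ge T n (x : 'rV[T]_n) e k : vcons x e (n + k)%N = e k.
Proof. by rewrite /vcons insubF ?addKn // ltnNge leq_addr. Qed.

Lemma vconsP T n (x : 'rV[T]_n) (e f : nat -> T) :
  (forall i : 'I_n, f i = x ord0 i) -> (forall k, f (n + k)%N = e k) ->
  f = vcons x e.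
Proof.
move=> h1 h2; apply/funext => k; have [kn|nk] := ltnP k n.
  by rewrite -[k]/(val (Ordinal kn)) vcons_lt h1.
by rewrite -(subnKC nk) vcons_ge h2.
Qed.

Definition vget T k n (e : nat -> T) : 'rV[T]_n := \row_i e (k + i)%N.

Lemma sat_iter_all L T (S : structure L T) n (p : formula L) : forall e,
  sat S e (iter n (@All L) p) <-> forall x : 'rV[T]_n, sat S (vcons x e) p.
Proof.
elim: n => [|n IH] e.
  have E (x : 'rV[T]_0) : e = vcons x e by apply: vconsP => //; case.
  by split=> [h x|/(_ (\row_i e i))]; rewrite -E.
rewrite iterS /=; split=> [h x|h a].
  have /IH := h (x ord0 ord_max).
  move=> /(_ (\row_i x ord0 (widen_ord (leqnSn n) i))).
  congr sat; apply: vconsP => [i|k]; last by rewrite addSnnS vcons_ge.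
  have [kn|nk] := ltnP i n.
    have -> : i = widen_ord (leqnSn n) (Ordinal kn) by exact: val_inj.
    by rewrite (vcons_lt _ _ (Ordinal kn)) mxE.
  have -> : i = ord_max by apply: val_inj; apply/eqP; rewrite eqn_leq nk -ltnS ltn_ord.
  by rewrite /= -[X in vcons _ _ X]addn0 vcons_ge.
apply/IH => x; have := h (\row_i vcons x (scons a e) i).
congr sat; apply/esym; apply: vconsP => [i|k]; first by rewrite mxE.
by rewrite addSnnS vcons_ge.
Qed.

Section Uniform.
Variable E : language.
Notation FE := (field_expansion E).
Notation pred_family := (forall M : FE, (nat -> M) -> Prop).

Definition uniform (P : pred_family) : Prop :=
  exists p : formula (full_language E),
    forall (M : FE) (e : nat -> M), P M e <-> sat (full M) e p.

Definition uniform_term (t : forall M : FE, (nat -> M) -> M) : Prop :=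
  exists u : term (full_language E),
    forall (M : FE) (e : nat -> M), t M e = eval (full M) e u.

Definition uniform_vec n (x : forall M : FE, (nat -> M) -> 'rV[M]_n) : Prop :=
  exists r : 'I_n -> nat, forall M e i, x M e ord0 i = e (r i).

Definition uniform_env (c : forall M : FE, (nat -> M) -> (nat -> M)) : Prop :=
  exists r : nat -> nat, forall M e k, c M e k = e (r k).

Lemma uniform_ext (P Q : pred_family) :
  (forall M e, P M e <-> Q M e) -> uniform Q -> uniform P.
Proof. by move=> h [p hp]; exists p => M e; rewrite h. Qed.

Lemma elementary_uniform (M M' : FE) (i : M -> M') (P : pred_family) e :
  elementary_extension i -> uniform P -> P M e -> P M' (i \o e).
Proof. by move=> hi [p hp]; rewrite !hp => /hi. Qed.

Lemma uniform_imp (P Q : pred_family) : uniform P -> uniform Q ->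
  uniform (fun M e => P M e -> Q M e).
Proof. by move=> [p hp] [q hq]; exists (Imp p q) => M e /=; rewrite hp hq. Qed.

Lemma uniform_not (P : pred_family) : uniform P -> uniform (fun M e => ~ P M e).
Proof. by move=> [p hp]; exists (Imp p Bot) => M e; rewrite hp. Qed.

Lemma uniform_and (P Q : pred_family) : uniform P -> uniform Q ->
  uniform (fun M e => P M e /\ Q M e).
Proof.
move=> uP uQ; apply: (@uniform_ext _ (fun M e => ~ (P M e -> ~ Q M e))).
  by move=> M e; rewrite not_implyE notK.
by apply: uniform_not; apply: uniform_imp => //; exact: uniform_not.
Qed.

Lemma uniform_true : uniform (fun _ _ => True).
Proof. by exists (Imp Bot Bot) => M e; split=> /=. Qed.

Lemma uniform_allI n (P : 'I_n -> pred_family) : (forall i, uniform (P i)) ->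
  uniform (fun M e => forall i, P i M e).
Proof.
elim: n P => [|n IH] P uP.
  by apply: uniform_ext uniform_true => M e; split=> // _ [].
apply: uniform_ext (uniform_and (uP ord0) (IH (fun i => P (lift ord0 i)) _)) => //.
move=> M e; split=> [h|[h0 hl] i]; first by split.
by case: (unliftP ord0 i) => [j|] ->.
Qed.

Lemma uniform_all (P : forall M : FE, M -> (nat -> M) -> Prop) :
  uniform (fun M e => P M (e 0%N) (fun k => e k.+1)) ->
  uniform (fun M e => forall a, P M a e).
Proof.
move=> [p hp]; exists (All p) => M e /=.
by split=> h a; [exact: (hp M (scons a e)).1 (h a)|exact: (hp M (scons a e)).2 (h a)].
Qed.

Lemma uniform_ex (P : forall M : FE, M -> (nat -> M) -> Prop) :
  uniform (fun M e => P M (e 0%N) (fun k => e k.+1)) ->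
  uniform (fun M e => exists a, P M a e).
Proof.
move=> uP; apply: (@uniform_ext _ (fun M e => ~ forall a, ~ P M a e)).
  by move=> M e; rewrite -existsNE; split=> -[a h]; exists a; move: h; rewrite notK.
by apply: uniform_not; apply: uniform_all; exact: uniform_not.
Qed.

Lemma uniform_allv n (P : forall M : FE, 'rV[M]_n -> (nat -> M) -> Prop) :
  uniform (fun M e => P M (vget 0 n e) (fun k => e (n + k)%N)) ->
  uniform (fun M e => forall x, P M x e).
Proof.
move=> [p hp]; exists (iter n (@All _) p) => M e; rewrite sat_iter_all.
have Ex x : vget 0 n (vcons x e) = x.
  by apply/rowP => i; rewrite mxE vcons_lt.
have Ee (x : 'rV[M]_n) : (fun k => vcons x e (n + k)%N) = e.
  by apply/funext => k /=; rewrite vcons_ge.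
by split=> h x; have := h x; rewrite -hp Ex Ee.
Qed.

Lemma uniform_exv n (P : forall M : FE, 'rV[M]_n -> (nat -> M) -> Prop) :
  uniform (fun M e => P M (vget 0 n e) (fun k => e (n + k)%N)) ->
  uniform (fun M e => exists x, P M x e).
Proof.
move=> uP; apply: (@uniform_ext _ (fun M e => ~ forall x, ~ P M x e)).
  by move=> M e; rewrite -existsNE; split=> -[x h]; exists x; move: h; rewrite notK.
by apply: uniform_not; apply: uniform_allv; exact: uniform_not.
Qed.

Lemma uniform_vget k n : uniform_vec (fun M => @vget M k n).
Proof. by exists (fun i => k + i)%N => M e i; rewrite mxE. Qed.

Lemma uniform_lsubmx m n (x : forall M : FE, (nat -> M) -> 'rV[M]_(m + n)) :
  uniform_vec x -> uniform_vec (fun M e => lsubmx (x M e)).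
Proof. by move=> [r hr]; exists (r \o lshift n) => M e i; rewrite mxE hr. Qed.

Lemma uniform_defined n p (x : forall M : FE, (nat -> M) -> 'rV[M]_n) c :
  uniform_vec x -> uniform_env c ->
  uniform (fun M e => defined_by p (c M e) (x M e)).
Proof.
move=> [r hr] [q hq].
pose t k := if insub k is Some i then r i else q (k - n)%N.
exists (rename t p) => M e; rewrite sat_rename /defined_by /=.
suff -> : vcons (x M e) (c M e) = e \o t by [].
by apply/funext => k; rewrite /vcons /t /=; case: insub.
Qed.

Lemma uniform_var k : uniform_term (fun M e => e k).
Proof. by exists (Var k). Qed.

Lemma uniform_coord n (x : forall M : FE, (nat -> M) -> 'rV[M]_n) i :
  uniform_vec x -> uniform_term (fun M e => x M e ord0 i).
Proof. by move=> [r hr]; exists (Var (r i)) => M e /=. Qed.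

Lemma uniform_zero : uniform_term (fun M e => 0).
Proof.
by exists (@App (full_language E) (inl FZero) (fun=> Var 0%N)).
Qed.

Lemma uniform_one : uniform_term (fun M e => 1).
Proof.
by exists (@App (full_language E) (inl FOne) (fun=> Var 0%N)).
Qed.

Lemma uniform_sub (t u : forall M : FE, (nat -> M) -> M) :
  uniform_term t -> uniform_term u -> uniform_term (fun M e => t M e - u M e).
Proof.
move=> [p hp] [q hq].
exists (@App (full_language E) (inl FAdd) (fun i => if val i == 0%N then p else
  @App (full_language E) (inl FOpp) (fun=> q))) => M e.
by rewrite /= hp hq.
Qed.

Lemma uniform_mul (t u : forall M : FE, (nat -> M) -> M) :
  uniform_term t -> uniform_term u -> uniform_term (fun M e => t M e * u M e).
Proof.
move=> [p hp] [q hq].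
exists (@App (full_language E) (inl FMul)
  (fun i => if val i == 0%N then p else q)) => M e.
by rewrite /= hp hq.
Qed.

Lemma uniform_eq (t u : forall M : FE, (nat -> M) -> M) :
  uniform_term t -> uniform_term u -> uniform (fun M e => t M e = u M e).
Proof. by move=> [p hp] [q hq]; exists (Eq p q) => M e; rewrite hp hq. Qed.

Lemma uniform_eqv n (x y : forall M : FE, (nat -> M) -> 'rV[M]_n) :
  uniform_vec x -> uniform_vec y -> uniform (fun M e => x M e = y M e).
Proof.
move=> ux uy.
apply: (@uniform_ext _ (fun M e => forall i, x M e ord0 i = y M e ord0 i)).
  by move=> M e; split=> [->//|h]; apply/rowP.
by apply: uniform_allI => i; apply: uniform_eq; exact: uniform_coord.
Qed.

Lemma uniform_term_env (t : forall M : FE, (nat -> M) -> M) :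
  uniform_term t -> uniform_term (fun M e => t M (fun k => e k.+1)).
Proof.
move=> [u hu]; exists (trename S u) => M e; rewrite hu eval_rename.
by congr eval.
Qed.

Lemma uniform_abs_le (t u : forall M : FE, (nat -> M) -> M) :
  uniform_term t -> uniform_term u ->
  uniform (fun M e => abs_le (t M e) (u M e)).
Proof.
move=> ut uu; apply: (@uniform_ext _
  (fun M e => exists a, Oset M a /\ t M e = u M e * a)).
  by move=> M e; split=> [[a Oa ->]|[a [Oa ->]]]; exists a.
apply: uniform_ex; apply: uniform_and.
  by exists (@Rel (full_language E) (inl tt) (fun=> Var 0%N)).
apply: uniform_eq; first exact: uniform_term_env.
by apply: uniform_mul; [exact: uniform_term_env|exact: uniform_var].
Qed.

Lemma uniform_abs_lt (t u : forall M : FE, (nat -> M) -> M) :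
  uniform_term t -> uniform_term u ->
  uniform (fun M e => abs_lt (t M e) (u M e)).
Proof.
move=> ut uu; apply: uniform_and; first exact: uniform_abs_le.
by apply: uniform_not; exact: uniform_abs_le.
Qed.

End Uniform.

Section Graph.
Variables (E : language) (M : field_expansion E) (n : nat).
Implicit Types (X : set 'rV[M]_n) (G : set 'rV[M]_(n + 1)).

Definition lastc T (v : 'rV[T]_(n + 1)) : T := v ord0 (rshift n ord0).

Lemma row_last_inj T (v w : 'rV[T]_(n + 1)) :
  lsubmx v = lsubmx w -> lastc v = lastc w -> v = w.
Proof.
move=> vw vw1; rewrite -[v]hsubmxK -[w]hsubmxK vw; congr row_mx.
by apply/rowP => j; rewrite !mxE !ord1.
Qed.

Lemma graphP X (f : X -> M) (v : 'rV[M]_(n + 1)) :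
  graph f v <-> exists2 x : X, val x = lsubmx v & f x = lastc v.
Proof.
split=> [[x _ <-]|[x xv fv]].
  by exists x; rewrite /lastc ?row_mxKl ?row_mxEr ?mxE.
exists x => //; rewrite xv fv -[RHS]hsubmxK; congr row_mx.
by apply/rowP => i; rewrite !mxE ord1.
Qed.

Definition interleave T (a b : nat -> T) : nat -> T :=
  fun k => if odd k then b k./2 else a k./2.
Definition evens T (c : nat -> T) : nat -> T := fun k => c k.*2.
Definition odds T (c : nat -> T) : nat -> T := fun k => c k.*2.+1.

Lemma evens_interleave T (a b : nat -> T) : evens (interleave a b) = a.
Proof.
by apply/funext => k; rewrite /evens /interleave odd_double doubleK.
Qed.

Lemma odds_interleave T (a b : nat -> T) : odds (interleave a b) = b.
Proof.
by apply/funext => k; rewrite /odds /interleave /= odd_double /= uphalf_double.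
Qed.

Lemma definable_uniform m
    (P : forall M : field_expansion E, 'rV[M]_m -> (nat -> M) -> Prop) c :
  uniform (fun M e => P M (vget 0 m e) (fun k => e (m + k)%N)) ->
  definable [set v | P M v c].
Proof.
move=> [p hp]; exists p, c; apply/seteqP; split=> v /=; rewrite /defined_by /= -hp.
all: have -> : vget 0 m (vcons v c) = v by apply/rowP => i; rewrite mxE vcons_lt.
all: by have -> : (fun k => vcons v c (m + k)%N) = c
  by apply/funext => k; rewrite vcons_ge.
Qed.

Lemma definable_fun_cst1 X : definable X -> definable_fun (fun _ : X => 1).
Proof.
move=> [p [a Xp]]; rewrite /definable_fun.
suff -> : graph (fun _ : X => 1)
    = [set v | defined_by p a (lsubmx v) /\ lastc v = 1].
  apply: (@definable_uniform _ (fun M v c => defined_by p c (lsubmx v) /\ lastc v = 1)).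
  apply: uniform_and.
    apply: uniform_defined; last by exists (addn (n + 1)).
    by apply: uniform_lsubmx; exact: uniform_vget.
  apply: uniform_eq (uniform_one E).
  by apply: uniform_coord; exact: uniform_vget.
apply/seteqP; split=> v; rewrite graphP /= -Xp.
  by move=> [x xv v1]; split=> //; rewrite -xv; exact: set_valP.
move=> [Xv v1].
by exists (SigSub (mem_set Xv)).
Qed.

Lemma definable_fun_op (op : forall M : field_expansion E, M -> M -> M)
    X (f g : X -> M) :
  (forall t u : forall M : field_expansion E, (nat -> M) -> M,
    uniform_term t -> uniform_term u ->
    uniform_term (fun M e => op M (t M e) (u M e))) ->
  definable_fun f -> definable_fun g ->
  definable_fun (fun x => op M (f x) (g x)).
Proof.
move=> uop [p [a fp]] [q [b gq]]; rewrite /definable_fun.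
pose P (M : field_expansion E) (v : 'rV[M]_(n + 1)) (c : nat -> M) :=
  exists u w : 'rV[M]_(n + 1),
    (defined_by p (evens c) u /\ defined_by q (odds c) w) /\
    ((lsubmx u = lsubmx v /\ lsubmx w = lsubmx v) /\
     lastc v = op M (lastc u) (lastc w)).
suff -> : graph (fun x => op M (f x) (g x)) = [set v | P M v (interleave a b)].
  apply: definable_uniform; rewrite /P.
  apply: uniform_exv; apply: uniform_exv; set N := (n + 1)%N.
  have u0 : uniform_vec (fun M : field_expansion E => @vget M 0 N) by exact: uniform_vget.
  have uu : uniform_vec (fun M : field_expansion E => fun e : nat -> M =>
      vget 0 N (fun k => e (N + k)%N)).
    by exists (fun i => N + i)%N => M' e i; rewrite mxE.
  have uv : uniform_vec (fun M : field_expansion E => fun e : nat -> M =>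
      vget 0 N (fun k => e (N + (N + k))%N)).
    by exists (fun i => N + (N + i))%N => M' e i; rewrite mxE.
  apply: uniform_and; first apply: uniform_and.
  - by apply: uniform_defined => //; exists (fun k => N + (N + (N + k.*2)))%N.
  - by apply: uniform_defined => //; exists (fun k => N + (N + (N + k.*2.+1)))%N.
  apply: uniform_and; first apply: uniform_and.
  - by apply: uniform_eqv; exact: uniform_lsubmx.
  - by apply: uniform_eqv; exact: uniform_lsubmx.
  - by apply: uniform_eq; [|apply: uop]; exact: uniform_coord.
apply/seteqP; split=> v.
all: rewrite graphP /P /= evens_interleave odds_interleave -fp -gq.
  move=> [x xv hv]; exists (row_mx (val x) (const_mx (f x))).
  exists (row_mx (val x) (const_mx (g x))); rewrite !row_mxKl /lastc !row_mxEr !mxE.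
  by split; [split; exists x|].
move=> [u [w [[/graphP[x xu fx] /graphP[y yw gy]] [[uv wv] hv]]]].
exists x; first by rewrite xu.
have -> : lastc v = op M (f x) (g x).
  by rewrite hv fx -gy; congr (op M _ (g _)); apply: val_inj; rewrite xu yw uv.
by [].
Qed.

End Graph.

Section Cdf.
Variables (E : language) (M : field_expansion E) (n : nat).
Variable X : definable_set M n.

Lemma cdf_subring_closed : subring_closed (mem (cdf X)).
Proof.
split.
- rewrite inE; split; first exact: continuous_cst.
  exact: definable_fun_cst1 (dsetP X).
- move=> f g; rewrite !inE => -[cf df] [cg dg]; split.
    exact: continuous_sub.
  by apply: (@definable_fun_op _ _ _ (fun M x y => x - y)) => //; exact: uniform_sub.
- move=> f g; rewrite !inE => -[cf df] [cg dg]; split.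
    exact: continuous_mul.
  by apply: (@definable_fun_op _ _ _ (fun M x y => x * y)) => //; exact: uniform_mul.
Qed.

Definition cdfType : Type := {f : X -> M | f \in cdf X}.

HB.instance Definition _ := [isSub for (@proj1_sig _ _ : cdfType -> (X -> M))].
HB.instance Definition _ := [Choice of cdfType by <:].
HB.instance Definition _ :=
  GRing.SubChoice_isSubComPzRing.Build _ _ cdfType cdf_subring_closed.

Definition cdf_bounded : set cdfType :=
  [set s | forall x : X, Oset M (val s x)].

Definition cdf_structure : structure ring_pred_language cdfType :=
  ring_pred_structure cdf_bounded.

End Cdf.

Section NaturalEmbedding.
Variables (E : language) (M M' : field_expansion E) (i : M -> M') (n : nat).

Definition continuous_graph (p : formula (full_language E))
    (q : formula (full_language E)) (K : field_expansion E) (c : nat -> K) :=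
  let X : set 'rV[K]_n := defined_by p (evens c) in
  let G : set 'rV[K]_(n + 1) := defined_by q (odds c) in
  ((forall v, G v -> X (lsubmx v)) /\
   (forall x, X x -> exists v, G v /\ lsubmx v = x)) /\
  ((forall v w, G v -> G w -> lsubmx v = lsubmx w -> v = w) /\
   (forall v, G v -> forall r : K, r <> 0 -> exists d : K, d <> 0 /\
     forall w, G w ->
       (forall j, abs_lt (lsubmx w ord0 j - lsubmx v ord0 j) d) ->
       abs_lt (lastc w - lastc v) r)).

Lemma uniform_continuous_graph p q : uniform (continuous_graph p q).
Proof.
have uv m k : uniform_vec (fun K : field_expansion E => fun e : nat -> K =>
    vget 0 m (fun j => e (k + j)%N)).
  by exists (fun j => k + j)%N => K e j; rewrite mxE.
apply: uniform_and; apply: uniform_and.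
- apply: uniform_allv; apply: uniform_imp; apply: uniform_defined.
  + exact: uniform_vget.
  + by exists (fun k => n + 1 + k.*2.+1)%N.
  + by apply: uniform_lsubmx; exact: uniform_vget.
  + by exists (fun k => n + 1 + k.*2)%N.
- apply: uniform_allv; apply: uniform_imp.
    apply: uniform_defined; first exact: uniform_vget.
    by exists (fun k => n + k.*2)%N.
  apply: uniform_exv; apply: uniform_and.
    apply: uniform_defined; first exact: uniform_vget.
    by exists (fun k => n + 1 + (n + k.*2.+1))%N.
  apply: uniform_eqv; first by apply: uniform_lsubmx; exact: uniform_vget.
  by exists (fun j => n + 1 + j)%N => K e j; rewrite !mxE.
- apply: uniform_allv; apply: uniform_allv; set N := (n + 1)%N.
  have u0 : uniform_vec (fun K : field_expansion E => @vget K 0 N).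
    exact: uniform_vget.
  have u1 := uv N N.
  apply: uniform_imp.
    by apply: uniform_defined => //; exists (fun k => N + (N + k.*2.+1))%N.
  apply: uniform_imp.
    by apply: uniform_defined => //; exists (fun k => N + (N + k.*2.+1))%N.
  apply: uniform_imp; last exact: uniform_eqv.
  by apply: uniform_eqv; exact: uniform_lsubmx.
- apply: uniform_allv; apply: uniform_imp.
    apply: uniform_defined; first exact: uniform_vget.
    by exists (fun k => n + 1 + k.*2.+1)%N.
  apply: uniform_all; apply: uniform_imp.
    apply: uniform_not; apply: uniform_eq (uniform_zero E).
    exact: uniform_var.
  apply: uniform_ex; apply: uniform_and.
    apply: uniform_not; apply: uniform_eq (uniform_zero E).
    exact: uniform_var.
  apply: uniform_allv; set N := (n + 1)%N.
  have u0 : uniform_vec (fun K : field_expansion E => @vget K 0 N).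
    exact: uniform_vget.
  have u2 : uniform_vec (fun (K : field_expansion E) (e : nat -> K) =>
      vget 0 N (fun k => e (N + k.+2)%N)).
    by exists (fun k => N + k.+2)%N => K e j; rewrite mxE.
  apply: uniform_imp.
    apply: uniform_defined => //.
    by exists (fun k => N + (N + k.*2.+1).+2)%N.
  apply: uniform_imp.
    apply: uniform_allI => j; apply: uniform_abs_lt.
      by apply: uniform_sub; apply: uniform_coord; exact: uniform_lsubmx.
    by exists (Var (N + 0)).
  apply: uniform_abs_lt.
    by apply: uniform_sub; exact: uniform_coord.
  by exists (Var (N + 1)).
Qed.

Lemma natural_image_exists (X : definable_set M n) (X' : definable_set M' n)
    (f : cdfType X) :
  elementary_extension i -> same_formula i X X' ->
  exists f' : cdfType X', same_formula i (graph (val f)) (graph (val f')).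
Proof.
move=> hi [p [a [Xp Xp']]].
have [cf [q [b fq]]] : cdf X (val f) by have := valP f; rewrite inE.
have ei : evens (i \o interleave a b) = i \o a.
  by rewrite -{2}(evens_interleave a b).
have oi : odds (i \o interleave a b) = i \o b.
  by rewrite -{2}(odds_interleave a b).
have : continuous_graph p q (interleave a b).
  rewrite /continuous_graph evens_interleave odds_interleave -Xp -fq.
  split; split.
  - by move=> v /graphP[x <- _]; exact: set_valP.
  - move=> x Xx; pose x' : X := SigSub (mem_set Xx).
    exists (row_mx x (const_mx (val f x'))); rewrite row_mxKl; split=> //.
    by exists x'.
  - move=> v w /graphP[x xv fx] /graphP[y yw fy] vw.
    have xy : x = y by apply: val_inj; rewrite xv vw yw.
    by apply: row_last_inj => //; rewrite -fx -fy xy.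
  - move=> v /graphP[x xv fx] r /eqP r0; have [d d0 hd] := cf x r r0.
    exists d; split; first exact/eqP.
    move=> w /graphP[y yw fy] h; rewrite -fx -fy; apply: hd => j.
    by rewrite !mxE; have := h j; rewrite -xv -yw.
move=> /(elementary_uniform hi (uniform_continuous_graph p q)).
rewrite /continuous_graph ei oi -Xp'.
set G := defined_by q (i \o b) => -[[GX XG] [Gu Gc]].
have [g hg] : {g : X' -> 'rV[M']_(n + 1) &
    forall x, G (g x) /\ lsubmx (g x) = val x}.
  apply: (@choice _ _ (fun (x : X') v => G v /\ lsubmx v = val x)) => x.
  exact: XG (val x) (set_valP x).
pose f' x := lastc (g x).
have Gf' : graph f' = G.
  apply/seteqP; split=> v; rewrite graphP.
    move=> [x xv fx]; have [Gg gx] := hg x; suff -> : v = g x by [].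
    by apply: row_last_inj; rewrite ?gx.
  move=> Gv; exists (SigSub (mem_set (GX v Gv))) => //.
  have [Gg gx] := hg (SigSub (mem_set (GX v Gv))).
  by rewrite /f' (Gu _ v Gg Gv).
have f'C : f' \in cdf X'.
  rewrite inE; split; last by exists q, (i \o b).
  move=> x r /eqP r0; have [Gg gx] := hg x; have [d [/eqP d0 hd]] := Gc _ Gg r r0.
  exists d => // y xy; have [Gh hx] := hg y; apply: hd => // j.
  by have := xy j; rewrite gx hx !mxE.
exists (SigSub f'C), q, b; split=> //=; exact: Gf'.
Qed.

(* The image of [f] does not depend on the choice made by [cid]: the set
   defined in [K'] depends only on the set defined in [K], since [i] is
   elementary, and a function is determined by its graph. *)
Definition natural_embedding (X : definable_set M n) (X' : definable_set M' n)
    (hi : elementary_extension i) (hX : same_formula i X X') :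
    cdfType X -> cdfType X' :=
  fun f => sval (cid (natural_image_exists f hi hX)).

End NaturalEmbedding.

(* Main.v *)
(* The ring [C(X)] with its predicate [B] sees the points of [X] (functions with
   exactly one zero, where having no common zero means generating the unit
   ideal), the value [f(p)] of a function up to the functions vanishing at [p],
   and the comparison [|f(p)| <= |g(p)|].  For [k] with the only zero [p], it
   therefore sees the set of cluster values at [p] of the quotient [g / k] along
   the zero set of [s].  Near a point with arbitrarily many germs every finite
   set of the form [{1, tau, ..., tau^N}] arises in this way, so if [|K^*|] is
   [tau]-archimedean and [|tau| < 1], then for every [x] with [x(p) <> 0] some
   bounded and uniformly separated set of cluster values contains [1] and, with
   each [a] such that [|a| > |x(p)|], also [tau a].  In [K'], for [x] below all
   powers of [tau], such a set would contain all these powers, although it is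
   definable, closed, bounded and discrete, hence finite. *)
Require Import Defs.
From mathcomp Require Import all_boot all_order all_algebra all_classical ring.
Set Implicit Arguments.
Unset Strict Implicit.
Import GRing.Theory.
Local Open Scope classical_set_scope.
Local Open Scope ring_scope.

(** * Definability with parameters *)

Section ParametricDefinability.
Variables (E : language) (M : field_expansion E).
Implicit Types (P Q : (nat -> M) -> Prop) (t u : (nat -> M) -> M).

(* [inl j] is the variable [j], [inr a] the parameter [a]. *)
Definition mix (r : nat -> nat + M) (e : nat -> M) : nat -> M :=
  fun k => match r k with inl j => e j | inr a => a end.

(** A predicate of a whole environment rather than of a vector, so that the closure properties below
    compose without tracking arities. In contrast to [uniform], one structure is fixed and its
    elements may serve as parameters. *)
Definition dpred P : Prop :=
  exists q r, forall e, P e <-> sat (full M) (mix r e) q.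

Lemma dpred_ext P Q : (forall e, P e <-> Q e) -> dpred Q -> dpred P.
Proof. by move=> PQ [q [r h]]; exists q, r => e; rewrite PQ. Qed.

Lemma dpred_mix s P : dpred P -> dpred (fun e => P (mix s e)).
Proof.
move=> [q [r h]]; exists q.
exists (fun k => match r k with inl j => s j | inr a => inr a end) => e.
rewrite h; suff -> : mix r (mix s e) =
  mix (fun k => match r k with inl j => s j | inr a => inr a end) e by [].
by apply/funext => k; rewrite /mix; case: (r k).
Qed.

Lemma dpred_rename (s : nat -> nat) P : dpred P -> dpred (fun e => P (e \o s)).
Proof. exact: (@dpred_mix (inl \o s)). Qed.

Lemma dpred_imp P Q : dpred P -> dpred Q -> dpred (fun e => P e -> Q e).
Proof.
move=> [p [r hp]] [q [s hq]].
(* Each formula keeps its own reading of the variables: [p] is moved to the even variables and [q]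
   to the odd ones. *)
exists (Imp (rename double p) (rename (S \o double) q)), (interleave r s) => e.
rewrite /= !sat_rename hp hq.
have -> : mix (interleave r s) e \o double = mix r e.
  by apply/funext => k; rewrite /mix /= -[in RHS](evens_interleave r s).
have -> : mix (interleave r s) e \o (S \o double) = mix s e.
  by apply/funext => k; rewrite /mix /= -[in RHS](odds_interleave r s).
by [].
Qed.

Lemma dpred_not P : dpred P -> dpred (fun e => ~ P e).
Proof. by move=> [p [r h]]; exists (Imp p Bot), r => e; rewrite h. Qed.

Lemma dpred_and P Q : dpred P -> dpred Q -> dpred (fun e => P e /\ Q e).
Proof.
move=> dP dQ; apply: (@dpred_ext _ (fun e => ~ (P e -> ~ Q e))).
  by move=> e; rewrite not_implyE notK.
by apply: dpred_not; apply: dpred_imp => //; exact: dpred_not.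
Qed.

Lemma dpred_or P Q : dpred P -> dpred Q -> dpred (fun e => P e \/ Q e).
Proof.
move=> dP dQ; apply: (@dpred_ext _ (fun e => ~ P e -> Q e)).
  by move=> e; rewrite implyE notK.
by apply: dpred_imp => //; exact: dpred_not.
Qed.

Lemma dpred_all P : dpred P -> dpred (fun e => forall a, P (scons a e)).
Proof.
move=> [q [r h]].
(* The variables that [r] sends to position 0 all become the bound variable; each other one moves
   past the quantifier, and [r'] lowers its position in the environment by one. *)
pose s k := match r k with inl 0 => 0%N | _ => k.+1 end.
pose r' k : nat + M :=
  match r k with inl j.+1 => inl j | inl 0 => inl 0%N | inr b => inr b end.
exists (All (rename s q)), r' => e /=.
split=> H a; have := H a; rewrite h sat_rename;
  suff -> : mix r (scons a e) = scons a (mix r' e) \o s by [];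
  by apply/funext => k; rewrite /mix /s /r' /=; case rk: (r k) => [[|j]|b] /=; rewrite ?rk.
Qed.

Lemma dpred_ex P : dpred P -> dpred (fun e => exists a, P (scons a e)).
Proof.
move=> dP; apply: (@dpred_ext _ (fun e => ~ forall a, ~ P (scons a e))).
  by move=> e; rewrite -existsNE; split=> -[a h]; exists a; move: h; rewrite notK.
by apply: dpred_not; apply: (dpred_all (dpred_not dP)).
Qed.

Lemma vcons_scons n (x : 'rV[M]_n.+1) e :
  vcons x e = scons (x ord0 ord0) (vcons (\row_j x ord0 (lift ord0 j)) e).
Proof.
apply/esym/vconsP => [j|k]; last by rewrite /= vcons_ge.
by case: (unliftP ord0 j) => [l|] -> //=; rewrite vcons_lt mxE.
Qed.

Lemma dpred_exv n P : dpred P -> dpred (fun e => exists x : 'rV[M]_n, P (vcons x e)).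
Proof.
elim: n P => [|n IH] P dP.
  have E0 (x : 'rV[M]_0) e : vcons x e = e by apply/esym/vconsP => //; case.
  apply: dpred_ext dP => e.
  by split=> [[x]|h]; [|exists (0 : 'rV_0)]; rewrite E0.
apply: dpred_ext (IH _ (dpred_ex dP)) => e; split=> [[x]|[x [a h]]].
  by rewrite vcons_scons => h; exists (\row_j x ord0 (lift ord0 j)), (x ord0 ord0).
exists (\row_j if unlift ord0 j is Some l then x ord0 l else a).
rewrite vcons_scons mxE unlift_none; move: h; congr P; congr scons.
by congr vcons; apply/rowP => j; rewrite !mxE liftK.
Qed.

Lemma definable_dpred n (X : set 'rV[M]_n) :
  definable X -> dpred (fun e => X (vget 0 n e)).
Proof.
move=> [p [c ->]]; exists p.
exists (fun k => if (k < n)%N then inl k else inr (c (k - n)%N)) => e.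
rewrite /defined_by /=; set r := (X in mix X e).
suff -> : mix r e = vcons (vget 0 n e) c by [].
apply: vconsP => [j|k]; first by rewrite /mix /r ltn_ord mxE.
by rewrite /mix /r ltnNge leq_addr /= addKn.
Qed.

Lemma dpred_definable n P :
  dpred P -> definable [set x : 'rV[M]_n | P (vcons x (fun=> 0))].
Proof.
move=> [q [r h]].
(* A variable that reads a coordinate goes to that coordinate, any other variable [k] to the
   parameter place [n + k]. Positions from [n] on read the default value 0 of the environment, which
   [c] reproduces. *)
pose s k := match r k with inl j => if (j < n)%N then j else (n + k)%N
                         | inr _ => (n + k)%N end.
pose c k := match r k with inl j => 0 | inr a => a end.
exists (rename s q), c; apply/seteqP; split=> x /=;
  rewrite /defined_by /= sat_rename h;
  suff -> : mix r (vcons x (fun=> 0)) = vcons x c \o s by [];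
  apply/funext => k; rewrite /mix /s /c /=; case rk: (r k) => [j|a];
  rewrite ?vcons_ge ?rk //; case: ltnP => nj;
  rewrite ?vcons_ge ?rk -1?[j]/(val (Ordinal nj)) ?vcons_lt //;
  by rewrite -(subnKC nj) vcons_ge.
Qed.

Definition shift T (e : nat -> T) : nat -> T := fun k => e k.+1.

(** Definability through the graph, with the value in position 0: inverses and case distinctions are
    definable without being given by terms. *)
Definition dterm t : Prop := dpred (fun e => e 0%N = t (shift e)).

Lemma dpred_atom (p : formula (full_language E)) :
  dpred (fun e => sat (full M) e p).
Proof. by exists p, inl => e. Qed.

Lemma dterm_ext t u : t =1 u -> dterm u -> dterm t.
Proof. by move=> tu; apply: dpred_ext => e; rewrite tu. Qed.

Lemma dterm_mix s t : dterm t -> dterm (fun e => t (mix s e)).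
Proof.
pose s' k : nat + M := if k is j.+1 then
  match s j with inl l => inl l.+1 | inr a => inr a end else inl 0%N.
move=> /(dpred_mix s'); apply: dpred_ext => e.
suff -> : shift (mix s' e) = mix s (shift e) by [].
by apply/funext => k; rewrite /mix /shift /s'; case: (s k).
Qed.

Lemma dterm_rename (s : nat -> nat) t : dterm t -> dterm (fun e => t (e \o s)).
Proof. exact: (@dterm_mix (inl \o s)). Qed.

Lemma dterm_var k : dterm (fun e => e k).
Proof. exact: (dpred_atom (Eq (Var 0) (Var k.+1))). Qed.

Lemma dterm_cst a : dterm (fun=> a).
Proof. exact: (@dterm_mix (fun=> inr a) _ (dterm_var 0)). Qed.

Lemma dpred_subst P t : dpred P -> dterm t -> dpred (fun e => P (scons (t e) e)).
Proof.
move=> dP dt; apply: dpred_ext (dpred_ex (dpred_and dP dt)) => e /=.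
by split=> [h|[a [h ta]]]; [exists (t e)|rewrite -[t e]ta].
Qed.

Lemma dpred_eq t u : dterm t -> dterm u -> dpred (fun e => t e = u e).
Proof.
move=> dt du; apply: dpred_ext (dpred_ex (dpred_and dt du)) => e.
by split=> [h|[a [ta ua]]]; [exists (t e)|rewrite -[t e]ta -[u e]ua].
Qed.

(** The operands occupy positions 0 and 1 of the hypothesis. [t] is substituted first, hence is
    shifted past both the second operand and the value. *)
Lemma dterm_op (op : M -> M -> M) t u :
  dpred (fun e => e 2 = op (e 0%N) (e 1%N)) -> dterm t -> dterm u ->
  dterm (fun e => op (t e) (u e)).
Proof.
move=> dop dt du; rewrite /dterm.
have h := dpred_subst dop (dterm_rename S (dterm_rename S dt)).
exact: (dpred_subst h (dterm_rename S du)).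
Qed.

Lemma uniform_dterm (t : forall M : field_expansion E, (nat -> M) -> M) :
  uniform_term t -> dpred (fun e => e 2 = t M e).
Proof.
move=> [u h]; have := dpred_atom (Eq (Var 2) u).
by apply: dpred_ext => e /=; rewrite h.
Qed.

Lemma dterm_mul t u : dterm t -> dterm u -> dterm (fun e => t e * u e).
Proof.
apply: dterm_op; apply: (@uniform_dterm (fun M e => e 0%N * e 1%N)).
by apply: uniform_mul; exact: uniform_var.
Qed.

Lemma dterm_sub t u : dterm t -> dterm u -> dterm (fun e => t e - u e).
Proof.
apply: (@dterm_op (fun x y => x - y)).
apply: (@uniform_dterm (fun M e => e 0%N - e 1%N)).
by apply: uniform_sub; exact: uniform_var.
Qed.

Lemma dterm_ite P t u : dpred P -> dterm t -> dterm u ->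
  dterm (fun e => if `[< P e >] then t e else u e).
Proof.
move=> dP dt du; have dP' := dpred_rename S dP.
apply: dpred_ext (dpred_or (dpred_and dP' dt) (dpred_and (dpred_not dP') du)) => e.
case: asboolP => [p|np]; split=> [->|]; try by [left|right].
  by case=> -[].
by case=> -[].
Qed.

Lemma dterm_inv t : dterm t -> dterm (fun e => (t e)^-1).
Proof.
move=> dt; have dt' : dterm (fun e => t (shift e)) by exact: (dterm_rename S dt).
have d0 := dterm_cst 0; have dv := dterm_var 0.
(* The inverse of 0 is 0 by convention, so the graph gets a separate branch there; elsewhere it is
   the equation value times [t] equals 1. *)
apply: dpred_ext (dpred_or (dpred_and (dpred_eq dt' d0) (dpred_eq dv d0))
  (dpred_eq (dterm_mul dv dt') (dterm_cst 1))) => e.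
have [->|t0] := eqVneq (t (shift e)) 0.
  rewrite invr0 mulr0; split=> [->|[[]//|/eqP]]; first by left.
  by rewrite eq_sym oner_eq0.
split=> [->|[[h]|]]; first by right; rewrite mulVf.
  by rewrite h eqxx in t0.
by move=> /(canRL (mulfK t0)); rewrite mul1r.
Qed.

Lemma dpred_Oset t : dterm t -> dpred (fun e => Oset M (t e)).
Proof.
apply: (@dpred_subst (fun e => Oset M (e 0%N))).
exact: (dpred_atom (@Rel (full_language E) (inl tt) (fun=> Var 0%N))).
Qed.

Lemma dpred_abs_le t u : dterm t -> dterm u -> dpred (fun e => abs_le (t e) (u e)).
Proof.
move=> dt du; have dv := dterm_var 0.
have dt' : dterm (fun e => t (shift e)) by exact: (dterm_rename S dt).
have du' : dterm (fun e => u (shift e)) by exact: (dterm_rename S du).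
apply: dpred_ext (dpred_ex (dpred_and (dpred_Oset dv)
  (dpred_eq dt' (dterm_mul du' dv)))) => e.
by split=> [[a Oa h]|[a [Oa h]]]; exists a.
Qed.

End ParametricDefinability.

(** * Absolute values and continuity *)

Section AbsoluteValue.
Variables (E : language) (M : field_expansion E).
Implicit Types (a b c r x y z : M).

Lemma abs_le_refl x : abs_le x x.
Proof. by have [O1 _ _ _ _] := OsetA M; exists 1; rewrite ?mulr1. Qed.

Lemma Oset0 : Oset M 0.
Proof. by have [_ _ _ OV _] := OsetA M; case: (OV 0); rewrite ?invr0. Qed.

Lemma abs_le0 r : abs_le 0 r.
Proof. by exists 0; [exact: Oset0|rewrite mulr0]. Qed.

Lemma abs_le_total x y : abs_le x y \/ abs_le y x.
Proof.
have [->|x0] := eqVneq x 0; first by left; exact: abs_le0.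
have [->|y0] := eqVneq y 0; first by right; exact: abs_le0.
have [_ _ _ OV _] := OsetA M; case: (OV (x / y)) => h; [left|right].
  by exists (x / y) => //; field.
by exists (x / y)^-1 => //; field; rewrite x0 y0.
Qed.

Lemma abs_lt_nle x y : abs_lt x y <-> ~ abs_le y x.
Proof.
split=> [[]//|h]; split=> //.
by case: (abs_le_total x y).
Qed.

Lemma abs_le_lt_trans y x z : abs_le x y -> abs_lt y z -> abs_lt x z.
Proof.
move=> xy [yz zy]; split; first exact: abs_le_trans yz.
by move=> zx; apply: zy; exact: abs_le_trans xy.
Qed.

Lemma abs_leN x y : abs_le (- x) y <-> abs_le x y.
Proof.
have [_ ON _ _ _] := OsetA M.
split=> -[a Oa h]; exists (- a); rewrite ?mulrN -?h ?opprK //; exact: ON.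
Qed.

Lemma abs_leB x y z : abs_le (x - y) z <-> abs_le (y - x) z.
Proof. by rewrite -abs_leN opprB. Qed.

Lemma abs_ltB x y z : abs_lt (x - y) z <-> abs_lt (y - x) z.
Proof.
have h (u v w : M) : abs_le w (u - v) -> abs_le w (v - u).
  move=> k; apply: (abs_le_trans k); apply/abs_leB; exact: abs_le_refl.
by split=> -[h1 h2]; (split=> [|/h /h2 //]; exact/abs_leB).
Qed.

Lemma abs_le_mul2l c x y : abs_le x y -> abs_le (c * x) (c * y).
Proof. by move=> [a Oa ->]; exists a; rewrite ?mulrA. Qed.

Lemma abs_le_mul2r c x y : abs_le x y -> abs_le (x * c) (y * c).
Proof. by rewrite ![_ * c]mulrC; exact: abs_le_mul2l. Qed.

Lemma abs_le_mul2lI c x y : c != 0 -> abs_le (c * x) (c * y) -> abs_le x y.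
Proof.
by move=> c0 [a Oa]; rewrite -mulrA => /(mulfI c0) ->; exists a.
Qed.

Lemma abs_le_mul x y z w : abs_le x y -> abs_le z w -> abs_le (x * z) (y * w).
Proof.
by move=> xy zw; apply: abs_le_trans (abs_le_mul2r _ xy) (abs_le_mul2l _ zw).
Qed.

Lemma abs_le_eq0 x : abs_le x 0 -> x = 0.
Proof. by move=> [a _]; rewrite mul0r. Qed.

Lemma abs_lt_irr x : ~ abs_lt x x.
Proof. by case. Qed.

Lemma abs_le_sqr x y : y ^+ 2 = x ^+ 2 -> abs_le y x.
Proof.
by move=> /eqP; rewrite eqf_sqr => /orP[] /eqP ->; rewrite ?abs_leN; exact: abs_le_refl.
Qed.

(** Keeps a continuous function away from 0 near a point where it does not vanish. For small [b], if
    also |y| <= |b|, then [x = y - (y - x)] would be smaller than itself. *)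
Lemma abs_lower x : x != 0 -> exists2 b, b != 0 &
  forall y, abs_le (y - x) b -> abs_le b y.
Proof.
move=> x0; have [r r0 hr] := abs_shrink x0; have [b b0 hb] := abs_sub r0.
exists b => // y yx; case: (abs_le_total b y) => // yb.
have := hr _ (hb _ _ yb yx); have -> : y - (y - x) = x by ring.
by move=> /abs_lt_irr.
Qed.

(** The ultrametric inequality, specific to the valued case. *)
Lemma valuation_ring_add : is_nontrivial_valuation_ring (Oset M) ->
  forall x y, abs_le x 1 -> abs_le y 1 -> abs_le (x + y) 1.
Proof.
move=> [G [v [[_ _ vD] _ OE]]] x y.
have le1 z : abs_le z 1 <-> Oset M z.
  by split=> [[a Oa ->]|Oz]; [rewrite mul1r|exists z; rewrite ?mul1r].
rewrite !le1 OE /= => hx hy.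
have [->|x0] := eqVneq x 0; first by rewrite add0r.
have [->|y0] := eqVneq y 0; first by rewrite addr0.
have [->|xy0] := eqVneq (x + y) 0; [by left|right].
have {}hx : (0 <= v x)%O by case: hx => // h; rewrite h eqxx in x0.
have {}hy : (0 <= v y)%O by case: hy => // h; rewrite h eqxx in y0.
apply: Order.le_trans (vD _ _ x0 y0 xy0).
by rewrite Order.POrderTheory.minEle; case: ifP.
Qed.

(** When [O] is the interval [-1, 1], comparing absolute values amounts to comparing squares, which
    is a sign condition. The sign of [d] persists near [d] because there [e = d (1 + a)] with [a] in
    [O] and [1 + a > 0]. *)
Lemma unit_interval_sign : is_unit_interval (Oset M) -> exists pos : M -> Prop,
  (forall x y, abs_le y x <-> pos (x ^+ 2 - y ^+ 2)) /\
  (forall d e, abs_lt (e - d) d -> (pos e <-> pos d)).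
Proof.
move=> [le [[rf an tr to] leD leM] OE]; exists (fun d => le 0 d).
have lesq x : le 0 (x * x).
  have [|/(leD _ _ (- x))] := orP (to 0 x); first by move=> h; exact: leM.
  by rewrite subrr add0r -mulrNN => h; exact: leM.
have O1 a : Oset M a -> le 0 (1 + a) /\ le 0 (1 - a).
  rewrite OE /= => /andP[/(leD _ _ 1) h1 /(leD _ _ (- a)) h2].
  by move: h1 h2; rewrite addNr subrr addrC.
have leV x : le 0 x -> le 0 x^-1.
  move=> x0; have [->|xn] := eqVneq x 0; first by rewrite invr0; exact: rf.
  have -> : x^-1 = x * (x^-1 * x^-1) by rewrite mulrA divff ?mul1r.
  by apply: leM => //; exact: lesq.
have leq x y : abs_le y x -> le 0 (x ^+ 2 - y ^+ 2).
  move=> [a /O1[h1 h2] ->].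
  have -> : x ^+ 2 - (x * a) ^+ 2 = (x * x) * ((1 + a) * (1 - a)) by ring.
  by apply: (leM); [exact: lesq|exact: leM].
split=> [x y|d e [[a /O1[a1 _] ea] nde]].
  split; first exact: leq.
  (* If |x| <= |y| instead, both differences of squares are nonnegative, so the squares agree and
     |y| <= |x| again. *)
  move=> h; case: (abs_le_total y x) => // /leq h'.
  apply: abs_le_sqr; apply/esym/eqP; rewrite -subr_eq0; apply/eqP.
  apply: an; rewrite h andbT.
  by move: h' => /(leD _ _ (x ^+ 2 - y ^+ 2)); rewrite add0r addrA subrK subrr.
have eE : e = d * (1 + a) by rewrite mulrDr mulr1 -ea addrC subrK.
split=> h; last by rewrite eE; exact: leM.
have an0 : 1 + a != 0.
  apply/negP => /eqP a0; apply: nde; rewrite eE a0 mulr0 sub0r.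
  by apply: abs_le_sqr; rewrite sqrrN.
have -> : d = e * (1 + a)^-1 by rewrite eE mulfK.
by apply: leM => //; exact: leV.
Qed.

End AbsoluteValue.

(** * Continuity at a point for functions on all vectors *)

Section Near.
Variables (E : language) (M : field_expansion E) (n : nat) (X : set 'rV[M]_n).
Implicit Types (F G P Q : 'rV[M]_n -> M) (x y : 'rV[M]_n).

(** Quantifies over vectors, not over a subtype, so that functions with different domains, once
    extended to all vectors, can be compared near one point. *)
Definition near_at x (A : 'rV[M]_n -> Prop) : Prop :=
  exists2 d : M, d != 0 & forall y, X y -> ball x d y -> A y.

Lemma near_at_true x (A : 'rV[M]_n -> Prop) : (forall y, X y -> A y) -> near_at x A.
Proof. by move=> h; exists 1; [exact: oner_neq0|move=> y Xy _; exact: h]. Qed.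

Lemma near_and2 x (A B C : 'rV[M]_n -> Prop) : near_at x A -> near_at x B ->
  (forall y, X y -> A y -> B y -> C y) -> near_at x C.
Proof.
move=> [r r0 hr] [s s0 hs] hABC; have [t t0 [tr ts]] := abs_le_min r0 s0.
exists t => // y Xy xy; apply: hABC => //; [apply: hr|apply: hs] => //.
  exact: ball_subset tr _ xy.
exact: ball_subset ts _ xy.
Qed.

Lemma near_sub x (A C : 'rV[M]_n -> Prop) : near_at x A ->
  (forall y, X y -> A y -> C y) -> near_at x C.
Proof. by move=> [r r0 hr] hAC; exists r => // y Xy xy; apply: hAC => //; exact: hr. Qed.

Lemma near_all (I : finType) x (A : I -> 'rV[M]_n -> Prop) :
  (forall k, near_at x (A k)) -> near_at x (fun y => forall k, A k y).
Proof.
move=> h.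
suff H (s : seq I) : near_at x (fun y => forall k, k \in s -> A k y).
  by apply: near_sub (H (enum I)) _ => y _ hy k; apply: hy; rewrite mem_enum.
elim: s => [|k s IH]; first exact: near_at_true.
apply: near_and2 (h k) IH _ => y _ Ay As l.
by rewrite in_cons => /orP[/eqP ->|/As].
Qed.

Definition cont_at F x : Prop :=
  forall r : M, r != 0 -> near_at x (fun y => abs_le (F y - F x) r).

Lemma cont_lt F x (r : M) : cont_at F x -> r != 0 ->
  near_at x (fun y => abs_lt (F y - F x) r).
Proof.
move=> cF r0; have [s s0 hs] := abs_shrink r0.
by apply: near_sub (cF s s0) _ => y _; exact: hs.
Qed.

Lemma cont_cst (c : M) x : cont_at (fun=> c) x.
Proof.
by move=> r r0; apply: near_at_true => y _; rewrite subrr; exact: abs_le0.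
Qed.

Lemma cont_coord k x : cont_at (fun v => v ord0 k) x.
Proof. by move=> r r0; exists r => // y _ /(_ k)[]; rewrite !mxE. Qed.

Lemma cont_local F G x : near_at x (fun y => F y = G y) -> F x = G x ->
  cont_at G x -> cont_at F x.
Proof.
by move=> FG Fx cG r r0; apply: near_and2 FG (cG r r0) _ => y _ -> ; rewrite Fx.
Qed.

Lemma cont_sub F G x : cont_at F x -> cont_at G x -> cont_at (fun y => F y - G y) x.
Proof.
move=> cF cG r r0; have [s s0 hs] := abs_sub r0.
apply: near_and2 (cF s s0) (cG s s0) _ => y _ h k.
have -> : F y - G y - (F x - G x) = (F y - F x) - (G y - G x) by ring.
exact: hs.
Qed.

Lemma cont_mul F G x : cont_at F x -> cont_at G x -> cont_at (fun y => F y * G y) x.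
Proof.
move=> cF cG r r0.
have [s s0 hs] := abs_sub r0; have [t t0 ht] := abs_sub s0.
have [u u0 hu] := abs_scale (- F x) t0; have [w w0 hw] := abs_scale (G x) t0.
have nF : near_at x (fun y => abs_le (F y - F x) 1 /\ abs_le (F y - F x) w).
  by apply: near_and2 (cF _ (oner_neq0 M)) (cF _ w0) _.
have nG : near_at x (fun y => abs_le (G y - G x) s /\ abs_le (G y - G x) u).
  by apply: near_and2 (cG _ s0) (cG _ u0) _.
apply: near_and2 nF nG _ => y _ [f1 fw] [gs gu].
have -> : F y * G y - F x * G x = (F y - F x) * (G y - G x)
    - (- F x * (G y - G x) - G x * (F y - F x)) by ring.
by apply: hs; [exact: abs_leM|apply: ht; [exact: hu|exact: hw]].
Qed.

Lemma cont_inv F x : F x != 0 -> cont_at F x -> cont_at (fun y => (F y)^-1) x.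
Proof.
move=> F0 cF r r0; have [b b0 hb] := abs_lower F0.
(* The difference of the inverses is [(F x - F y) / (F y * F x)], and |b| <= |F y| near [x]; this
   bound on the numerator therefore gives |r|. *)
have s0 : r * (b * F x) != 0 by rewrite !mulf_neq0.
apply: near_and2 (cF b b0) (cF _ s0) _ => y _ /hb bF h.
have Fy0 : F y != 0 by apply: contraNneq b0 => Fy; apply/eqP/abs_le_eq0; rewrite -Fy.
apply: (@abs_le_mul2lI _ _ (F y * F x)); first exact: mulf_neq0.
have -> : F y * F x * ((F y)^-1 - (F x)^-1) = F x - F y by field; rewrite F0 Fy0.
apply/abs_leB; apply: abs_le_trans h _; rewrite mulrC.
by apply: abs_le_mul2r; exact: abs_le_mul2r.
Qed.

(* In the ordered case the sign of [F^2 - G^2] decides the comparison; in the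
   valued case the comparison is locally constant outside the common zeros. *)
Lemma abs_le_stable F G x : cont_at F x -> cont_at G x -> F x ^+ 2 != G x ^+ 2 ->
  near_at x (fun y => abs_le (G y) (F y) <-> abs_le (G x) (F x)).
Proof.
move=> cF cG FG; case: (OsetP M) => [/unit_interval_sign[pos [le_pos pos_near]]|].
  have cD := cont_sub (cont_mul cF cF) (cont_mul cG cG).
  have D0 : F x * F x - G x * G x != 0 by rewrite subr_eq0 -!expr2.
  apply: near_sub (cont_lt cD D0) _ => y _ /pos_near.
  by rewrite -!expr2 !le_pos.
move=> /valuation_ring_add add1.
have add_le (a b c : M) : abs_le a c -> abs_le b c -> abs_le (a + b) c.
  move=> [u Ou ->] [w Ow ->]; rewrite -mulrDr -{2}[c]mulr1.
  by apply: abs_le_mul2l; apply: add1; [exists u|exists w]; rewrite ?mul1r.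
have sub_lt (a b c : M) : abs_lt a c -> abs_lt b c -> abs_lt (a - b) c.
  move=> ac bc; case: (abs_le_total a b) => h.
    by apply: abs_le_lt_trans bc; apply: add_le => //; apply/abs_leN; exact: abs_le_refl.
  by apply: abs_le_lt_trans ac; apply: add_le => //; [exact: abs_le_refl|apply/abs_leN].
have below (a b c : M) : abs_lt (b - a) c -> abs_le c a -> abs_le c b.
  move=> ba ca; case: (abs_le_total c b) => // bc; apply: contrapT => ncb.
  have : abs_lt (b - (b - a)) c by apply: sub_lt => //; split.
  by have -> : b - (b - a) = a by [ring]; move=> [].
have [GF|FG'] := pselect (abs_le (G x) (F x)).
  have F0 : F x != 0.
    by apply: contra_neq FG => F0; move: GF; rewrite F0 => /abs_le_eq0 ->.
  apply: near_and2 (cont_lt cF F0) (cG _ F0) _ => y _ hF hG; split=> // _.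
  apply: abs_le_trans (below _ _ _ hF (abs_le_refl _)).
  have -> : G y = (G y - G x) + G x by ring.
  exact: add_le.
have FGx : abs_lt (F x) (G x) by apply/abs_lt_nle.
have G0 : G x != 0.
  by apply/eqP => G0; move: FG'; rewrite G0; apply; exact: abs_le0.
apply: near_and2 (cont_lt cF G0) (cont_lt cG G0) _ => y _ hF hG; split=> // GFy.
have Gxy := below _ _ _ hG (abs_le_refl _).
have : abs_lt (F x - (F x - F y)) (G x) by apply: sub_lt => //; apply/abs_ltB.
have -> : F x - (F x - F y) = F y by ring.
by move=> /abs_lt_nle; case; exact: abs_le_trans GFy.
Qed.

(** Gluing along a comparison: where the squares differ, the same branch is taken throughout a
    neighborhood; where they agree, both branches are continuous with the same value. *)
Lemma cont_ite F G P Q x : cont_at F x -> cont_at G x ->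
  (abs_le (G x) (F x) -> cont_at P x) -> (~ abs_le (G x) (F x) -> cont_at Q x) ->
  (F x ^+ 2 = G x ^+ 2 -> cont_at Q x /\ P x = Q x) ->
  cont_at (fun y => if `[< abs_le (G y) (F y) >] then P y else Q y) x.
Proof.
move=> cF cG cP cQ FG; set H := fun y => _.
have [eq|ne] := eqVneq (F x ^+ 2) (G x ^+ 2).
  have [cQ' PQ] := FG eq.
  have {}cP : cont_at P x by apply: cP; exact: abs_le_sqr.
  have Hx : H x = P x by rewrite /H; case: ifP.
  move=> r r0; apply: near_and2 (cP r r0) (cQ' r r0) _ => y _.
  by rewrite Hx /H PQ; case: ifP.
have st := abs_le_stable cF cG ne.
have [GF|nGF] := pselect (abs_le (G x) (F x)).
  apply: cont_local (cP GF); last by rewrite /H; case: asboolP.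
  by apply: near_sub st _ => y _ h; rewrite /H; case: asboolP => // /h.
apply: cont_local (cQ nGF); last by rewrite /H; case: asboolP.
by apply: near_sub st _ => y _ h; rewrite /H; case: asboolP => // /h.
Qed.

End Near.

(** * The ring of continuous definable functions *)

Section TotalFunctions.
Variables (E : language) (M : field_expansion E) (n : nat).
Implicit Types (D : set 'rV[M]_n) (F G P Q : 'rV[M]_n -> M).

Definition dfun F : Prop := dterm (fun e => F (vget 0 n e)).

Lemma dfun_cst a : dfun (fun=> a).
Proof. exact: dterm_cst. Qed.

Lemma dfun_coord k : dfun (fun v => v ord0 k).
Proof. by apply: dterm_ext (dterm_var M k) => e; rewrite mxE. Qed.

Lemma dfun_ite F G P Q : dfun F -> dfun G -> dfun P -> dfun Q ->
  dfun (fun v => if `[< abs_le (G v) (F v) >] then P v else Q v).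
Proof. by move=> dF dG; apply: dterm_ite; exact: dpred_abs_le. Qed.

(** Extension by 0, which allows functions on [X], on a neighborhood [U] and on [U] without a point
    to be multiplied with one another. *)
Definition ftot D (f : D -> M) : 'rV[M]_n -> M :=
  fun v => if insub v is Some x then f x else 0.

Lemma ftotE D (f : D -> M) (x : D) : ftot f (val x) = f x.
Proof. by rewrite /ftot valK. Qed.

Lemma ftot_out D (f : D -> M) v : ~ D v -> ftot f v = 0.
Proof. by move=> Dv; rewrite /ftot insubF //; apply/negbTE/negP; rewrite inE. Qed.

Lemma graph_ftot D (f : D -> M) v :
  graph f v <-> D (lsubmx v) /\ ftot f (lsubmx v) = lastc v.
Proof.
rewrite graphP; split=> [[x <- <-]|[Dv <-]].
  by rewrite ftotE; split=> //; exact: set_valP.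
by exists (SigSub (mem_set Dv)) => //; rewrite -ftotE.
Qed.

Lemma dfun_ftot D (f : D -> M) : definable_fun f -> dfun (ftot f).
Proof.
move=> /definable_dpred dg.
(* [s m] reads the vector from position [m] on and the value from position 0; [m] is 2 under the
   quantifier over a value. Outside [D] the graph has no point above the vector, and the value has
   to be 0. *)
pose s m k := if (k < n)%N then (m + k)%N else 0%N.
have Es m (e : nat -> M) : lsubmx (vget 0 (n + 1) (e \o s m)) = vget m n e.
  by apply/rowP => j; rewrite !mxE /= /s add0n ltn_ord.
have Ea m (e : nat -> M) : lastc (vget 0 (n + 1) (e \o s m)) = e 0%N.
  by rewrite /lastc mxE /= /s add0n ltnNge leq_addr.
have d0 := dpred_eq (dterm_var M 0) (dterm_cst (0 : M)).
apply: dpred_ext (dpred_or (dpred_rename (s 1%N) dg)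
  (dpred_and (dpred_not (dpred_ex (dpred_rename (s 2) dg))) d0)) => e.
rewrite graph_ftot Es Ea.
have -> : vget 1 n e = vget 0 n (shift e) by apply/rowP => j; rewrite !mxE.
set v := vget 0 n _.
have Ev a : vget 2 n (scons a e) = v by apply/rowP => j; rewrite !mxE.
have [Dv|nDv] := pselect (D v).
  split=> [->|[[_ ->//]|[]]]; first by left.
  by case; exists (ftot f v); rewrite graph_ftot Es Ea Ev.
rewrite ftot_out //; split=> [->|[[]|[]]] //; right; split=> // -[a].
by rewrite graph_ftot Es Ev => -[].
Qed.

Lemma definable_fun_restrict D F :
  definable D -> dfun F -> definable_fun (fun x : D => F (val x)).
Proof.
move=> dD dF; rewrite /definable_fun.
have dP := dpred_and (definable_dpred dD) (dpred_eq (dterm_var M (n + 0)%N) dF).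
have := dpred_definable (n + 1) dP; congr definable.
apply/seteqP; split=> v; rewrite graphP /=.
all: have -> : vget 0 n (vcons v (fun=> 0)) = lsubmx v
  by apply/rowP => j; rewrite !mxE (vcons_lt _ _ (lshift 1 j)).
all: rewrite (vcons_lt _ _ (rshift n (@ord0 0))).
  by move=> [Dv vF]; exists (SigSub (mem_set Dv)).
by move=> [x <- Fx]; split=> //; exact: set_valP.
Qed.

Lemma cont_ftot D (X : set 'rV[M]_n) (f : D -> M) (x : D) : continuous_fun f ->
  near_at X (val x) D -> cont_at X (ftot f) (val x).
Proof.
move=> cf nD r r0; have [d d0 hd] := cf x r r0.
apply: near_and2 nD _ (fun y _ Dy h => h Dy).
exists d => // y _ xy Dy; rewrite ftotE.
by have [] := hd (SigSub (mem_set Dy)) xy; rewrite -ftotE.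
Qed.

End TotalFunctions.

(** * Elements of [C(X)] with prescribed zeros or supports *)

Section FunctionRing.
Variables (E : language) (M : field_expansion E) (n : nat) (X : definable_set M n).
Local Notation R := (cdfType X).
Implicit Types (f g h k : R) (x y p : X).

Definition ev x f : M := val f x.

Lemma ev_cdf f : continuous_fun (val f) /\ definable_fun (val f).
Proof. by have := valP f; rewrite inE. Qed.

Lemma ev_inj f g : (forall x, ev x f = ev x g) -> f = g.
Proof. by move=> h; apply: val_inj; apply/funext. Qed.

Lemma evD x f g : ev x (f + g) = ev x f + ev x g. Proof. by []. Qed.
Lemma evM x f g : ev x (f * g) = ev x f * ev x g. Proof. by []. Qed.
Lemma evN x f : ev x (- f) = - ev x f. Proof. by []. Qed.
Lemma ev1 x : ev x 1 = 1. Proof. by []. Qed.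
Lemma ev0 x : ev x 0 = 0. Proof. by []. Qed.
Definition evE := (evD, evM, evN, ev1, ev0).

Lemma ev_sum (I : finType) x (F : I -> R) : ev x (\sum_j F j) = \sum_j ev x (F j).
Proof. exact: (big_morph (ev x) (evD x) (ev0 x)). Qed.

Lemma ev_prod (I : finType) x (F : I -> R) : ev x (\prod_j F j) = \prod_j ev x (F j).
Proof. exact: (big_morph (ev x) (evM x) (ev1 x)). Qed.

Lemma set_XP x : dset X (val x). Proof. exact: set_valP. Qed.

Lemma cdf_make (F : 'rV[M]_n -> M) : dfun F ->
  (forall x, cont_at X F (val x)) -> exists f, forall x, ev x f = F (val x).
Proof.
move=> dF cF; have fC : (fun x : X => F (val x)) \in cdf X.
  rewrite inE; split; last by apply: definable_fun_restrict => //; exact: dsetP.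
  apply/continuous_funP => x r /(cF x)[d d0 hd].
  by exists d => // y; apply: hd; exact: set_XP.
by exists (SigSub fC).
Qed.

Lemma dfun_ev f : dfun (ftot (val f)).
Proof. by apply: dfun_ftot; case: (ev_cdf f). Qed.

Lemma cont_ev f x : cont_at X (ftot (val f)) (val x).
Proof.
apply: cont_ftot; first by case: (ev_cdf f).
exact: near_at_true.
Qed.

Lemma near_ev f x (r : M) : r != 0 ->
  exists2 d, d != 0 & forall y, ball (val x) d (val y) -> abs_le (ev y f - ev x f) r.
Proof.
move=> /(cont_ev f x)[d d0 hd]; exists d => // y xy.
by have := hd _ (set_XP y) xy; rewrite !ftotE.
Qed.

Definition cstf (a : M) : R :=
  sval (cid (cdf_make (dfun_cst n a) (fun x => cont_cst X a (val x)))).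

Lemma ev_cst a x : ev x (cstf a) = a.
Proof. by rewrite /cstf; case: cid => f /= ->. Qed.

Lemma cdf_coord j : exists f, forall x, ev x f = val x ord0 j.
Proof. exact: cdf_make (dfun_coord M j) (fun x => cont_coord X j (val x)). Qed.

(* The coefficient of [g] is made to vanish where [|g| <= |f|]; the two
   definitions agree where [f^2 = g^2]. *)
Lemma bezout_function f g : (forall x, ev x f = 0 -> ev x g <> 0) ->
  exists a b, a * f + b * g = 1 /\ forall x, abs_le (ev x g) (ev x f) -> ev x b = 0.
Proof.
move=> fg; pose F := ftot (val f); pose G := ftot (val g).
have dF : dfun F := dfun_ev f; have dG : dfun G := dfun_ev g.
have cF x : cont_at X F (val x) := cont_ev f x.
have cG x : cont_at X G (val x) := cont_ev g x.
have F0 x : abs_le (G (val x)) (F (val x)) -> F (val x) != 0.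
  rewrite /F /G !ftotE => gf; apply/eqP => f0; apply: (fg x f0).
  by apply: abs_le_eq0; rewrite -f0.
have G0 x : ~ abs_le (G (val x)) (F (val x)) -> G (val x) != 0.
  by move=> h; apply/eqP => g0; apply: h; rewrite g0; exact: abs_le0.
have eqFG x : F (val x) ^+ 2 = G (val x) ^+ 2 -> F (val x) != 0 /\ G (val x) != 0.
  move=> eq; have f0 := F0 x (abs_le_sqr (esym eq)); split=> //.
  by rewrite -sqrf_eq0 -eq sqrf_eq0.
have [a Ea] : exists a, forall x, ev x a =
    if `[< abs_le (G (val x)) (F (val x)) >] then (F (val x))^-1
    else F (val x) * (G (val x) * G (val x))^-1.
  apply: (@cdf_make (fun v => if `[< abs_le (G v) (F v) >] then (F v)^-1
    else F v * (G v * G v)^-1)).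
    apply: dfun_ite => //; first exact: dterm_inv.
    by apply: dterm_mul => //; apply: dterm_inv; exact: dterm_mul.
  move=> x; have cQ : G (val x) != 0 ->
      cont_at X (fun v => F v * (G v * G v)^-1) (val x).
    move=> g0; apply: cont_mul => //; apply: cont_inv; first exact: mulf_neq0.
    exact: cont_mul.
  apply: cont_ite => // [/F0 f0|/G0 //|eq]; first exact: cont_inv.
  have [f0 g0] := eqFG x eq; split; first exact: cQ.
  by rewrite -expr2 -eq expr2 invfM mulrA divff ?mul1r.
have [b Eb] : exists b, forall x, ev x b =
    if `[< abs_le (G (val x)) (F (val x)) >] then 0
    else (1 - (F (val x) * F (val x)) * (G (val x) * G (val x))^-1) * (G (val x))^-1.
  apply: (@cdf_make (fun v => if `[< abs_le (G v) (F v) >] then 0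
    else (1 - (F v * F v) * (G v * G v)^-1) * (G v)^-1)).
    apply: dfun_ite => //; first exact: dterm_cst.
    apply: dterm_mul; last exact: dterm_inv.
    apply: dterm_sub; first exact: dterm_cst.
    by apply: dterm_mul; [exact: dterm_mul|apply: dterm_inv; exact: dterm_mul].
  move=> x; have cQ : G (val x) != 0 ->
      cont_at X (fun v => (1 - (F v * F v) * (G v * G v)^-1) * (G v)^-1) (val x).
    move=> g0; apply: cont_mul; last exact: cont_inv.
    apply: cont_sub; first exact: cont_cst.
    apply: cont_mul; first exact: cont_mul.
    by apply: cont_inv; [exact: mulf_neq0|exact: cont_mul].
  apply: cont_ite => // [_|/G0 //|eq]; first exact: cont_cst.
  have [f0 g0] := eqFG x eq; split; first exact: cQ.
  by rewrite -!expr2 eq divff ?subrr ?mul0r // expf_eq0.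
exists a, b; split=> [|x gf].
  apply: ev_inj => x; rewrite !evE Ea Eb.
  rewrite -[ev x f](ftotE (val f)) -[ev x g](ftotE (val g)) -/F -/G.
  case: asboolP => [/F0 f0|/G0 g0]; first by rewrite mulVf ?mul0r ?addr0.
  by field.
by rewrite Eb; case: asboolP => //; rewrite /F /G !ftotE.
Qed.

(** The larger of [f^2] and [g^2] vanishes only where both do, and squaring makes the two branches
    agree where they meet. In a valued field a sum of squares could have further zeros. *)
Lemma zero_meet f g : exists h, forall x, ev x h = 0 <-> ev x f = 0 /\ ev x g = 0.
Proof.
pose F := ftot (val f); pose G := ftot (val g).
have dF : dfun F := dfun_ev f; have dG : dfun G := dfun_ev g.
have cF x : cont_at X F (val x) := cont_ev f x.
have cG x : cont_at X G (val x) := cont_ev g x.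
have [h Eh] : exists h, forall x, ev x h =
    if `[< abs_le (G (val x)) (F (val x)) >] then F (val x) * F (val x)
    else G (val x) * G (val x).
  apply: (@cdf_make (fun v => if `[< abs_le (G v) (F v) >] then F v * F v
    else G v * G v)); first by apply: dfun_ite => //; exact: dterm_mul.
  by move=> x; apply: cont_ite => // *; [exact: cont_mul|exact: cont_mul|
    split; [exact: cont_mul|]].
exists h => x; rewrite Eh -[ev x f](ftotE (val f)) -[ev x g](ftotE (val g)) -/F -/G.
case: asboolP => [gf|gf]; split=> [/eqP|[f0 g0]].
- rewrite mulf_eq0 orbb => /eqP f0; split=> //; apply: abs_le_eq0.
  by rewrite -f0.
- by rewrite f0 mulr0.
- rewrite mulf_eq0 orbb => /eqP g0; case: gf; rewrite g0; exact: abs_le0.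
- by rewrite g0 mulr0.
Qed.

Lemma zero_meets (I : finType) (F : I -> R) :
  exists h, forall x, ev x h = 0 <-> forall j, ev x (F j) = 0.
Proof.
suff [h H] : exists h, forall x,
    ev x h = 0 <-> forall j, j \in enum I -> ev x (F j) = 0.
  exists h => x; rewrite H; split=> hx j; last by move=> _.
  by apply: hx; rewrite mem_enum.
elim: (enum I) => [|j s [h H]]; first by exists 0.
have [h' H'] := zero_meet (F j) h; exists h' => x; rewrite H' H.
split=> [[Fj Fs] l|Fs].
  by rewrite in_cons => /orP[/eqP ->|/Fs].
by split=> [|l ls]; apply: Fs; rewrite in_cons ?eqxx ?ls ?orbT.
Qed.

Lemma point_function p : exists k, forall x, ev x k = 0 <-> x = p.
Proof.
have [c Ec] := choice (fun j => cdf_coord j).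
have [k Ek] := zero_meets (fun j => c j - cstf (val p ord0 j)).
exists k => x; rewrite Ek; split=> [h|-> j]; last by rewrite !evE ev_cst Ec subrr.
apply: val_inj; apply/rowP => j; apply/eqP; rewrite -subr_eq0; apply/eqP.
by have := h j; rewrite !evE ev_cst Ec.
Qed.

(** For each coordinate, [bezout_function] is applied to [x_j - p_j] and the constant [r]: the
    coefficient of [r] vanishes where |x_j - p_j| >= |r|, and its product with [r] is 1 at [p]. The
    product over all coordinates is the bump. *)
Lemma bump_function p (r : M) : r != 0 ->
  exists h, ev p h = 1 /\ forall x, ev x h <> 0 -> ball (val p) r (val x).
Proof.
move=> r0.
have H j : exists b, ev p b = 1 /\
    forall x, ev x b <> 0 -> abs_lt (val x ord0 j - val p ord0 j) r.
  have [c Ec] := cdf_coord j.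
  have [|a [b [ab b0]]] := @bezout_function (c - cstf (val p ord0 j)) (cstf r).
    by move=> x _; rewrite ev_cst; exact/eqP.
  exists (b * cstf r); split.
    have := congr1 (ev p) ab; rewrite !evE !ev_cst Ec subrr mulr0 add0r.
    by [].
  move=> x; rewrite !evE ev_cst => bx; apply/abs_lt_nle => h; apply: bx.
  by rewrite b0 ?mul0r // !evE !ev_cst Ec.
have [b Hb] := choice H; exists (\prod_j b j); rewrite ev_prod; split.
  by rewrite big1 // => j _; case: (Hb j).
move=> x; rewrite ev_prod => /eqP/prodf_neq0 bx j; rewrite !mxE.
by apply: (Hb j).2; exact/eqP/bx.
Qed.

End FunctionRing.

(** * Points and cluster values in the language of rings *)

Section PointsInRings.
Variables (R : pzRingType) (B : set R).
Implicit Types (a b c f g h j k l s t x : R).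

(* In [C(X)], where every [k] below has exactly one zero [p]:
   [coprime_fun f g]: no common zero; [van f k]: [f] vanishes at [p];
   [le_at f g k]: [|f(p)| <= |g(p)|]; [cluster k g s a]: [a(p)] is a cluster
   value at [p] of [g / k] along the zeros of [s]. *)
Definition coprime_fun f g := exists a b, a * f + b * g = 1.
Definition van f k := ~ coprime_fun f k.
Definition is_point k := van k k /\ forall f l, van f k -> van l k -> van f l.
Definition le_at f g k := exists b, B b /\ van (f - b * g) k.
Definition cluster k g s a := forall h e, ~ van h k -> ~ van e k ->
  exists j, is_point j /\ (van s j /\ (~ van k j /\ (~ van h j /\
    le_at (g - a * k) (e * k) j))).

(** [g] and [s] produce the set of cluster values, [c] is a lower bound for the distance between two
    different ones, and [x] is the size at which multiplication by [t] may stop. *)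
Definition geometric_progressions t :=
  exists k, is_point k /\ forall x, ~ van x k -> exists g s c,
    ~ van c k /\ (cluster k g s 1 /\
    forall a, cluster k g s a -> le_at a 1 k /\
      ((le_at a x k \/ cluster k g s (t * a)) /\
      forall b, cluster k g s b -> van (a - b) k \/ le_at c (a - b) k)).

(** * Formulas that express these notions *)

Local Notation L := ring_pred_language.
Local Notation S := (ring_pred_structure B).
Implicit Types (e : nat -> R) (p q : formula L) (u v : term L).

Definition one_term : term L := @App L FOne (fun=> Var 0).
Definition mul_term u v : term L := @App L FMul (fun i => if val i == 0%N then u else v).
Definition sub_term u v : term L := @App L FAdd
  (fun i => if val i == 0%N then u else @App L FOpp (fun=> v)).
Definition add_term u v : term L := @App L FAdd (fun i => if val i == 0%N then u else v).
Definition lift_term u : term L := trename succn u.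
Definition not_form p := Imp p Bot.
Definition ex_form p := not_form (All (not_form p)).
Definition and_form p q := not_form (Imp p (not_form q)).
Definition or_form p q := Imp (not_form p) q.

(** Equalities of propositions rather than equivalences, so that they pass under binders by
    [eq_forall] and [eq_exists]. *)
Lemma sat_not e p (P : Prop) : sat S e p = P -> sat S e (not_form p) = ~ P.
Proof. by move=> <-. Qed.

Lemma sat_imp e p q (P Q : Prop) : sat S e p = P -> sat S e q = Q ->
  sat S e (Imp p q) = (P -> Q).
Proof. by move=> <- <-. Qed.

Lemma sat_and e p q (P Q : Prop) : sat S e p = P -> sat S e q = Q ->
  sat S e (and_form p q) = (P /\ Q).
Proof.
move=> <- <-; rewrite -[LHS]/(~ (sat S e p -> ~ sat S e q)).
by rewrite not_implyE notK.
Qed.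

Lemma sat_or e p q (P Q : Prop) : sat S e p = P -> sat S e q = Q ->
  sat S e (or_form p q) = (P \/ Q).
Proof.
by move=> <- <-; rewrite -[LHS]/(~ sat S e p -> sat S e q) implyE notK.
Qed.

Lemma sat_all e p (P : R -> Prop) : (forall a, sat S (scons a e) p = P a) ->
  sat S e (All p) = forall a, P a.
Proof. exact: eq_forall. Qed.

Lemma sat_ex e p (P : R -> Prop) : (forall a, sat S (scons a e) p = P a) ->
  sat S e (ex_form p) = exists a, P a.
Proof.
move=> pP; rewrite -[LHS]/(~ forall a, ~ sat S (scons a e) p) -existsNE.
by apply: eq_exists => a; rewrite notK.
Qed.

Lemma eval_lift a e u : eval S (scons a e) (lift_term u) = eval S e u.
Proof. by rewrite eval_rename. Qed.

Local Notation "u ^1" := (lift_term u) (at level 2, format "u ^1").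
Local Notation "u ^2" := (lift_term u^1) (at level 2, format "u ^2").
Local Notation "u ^3" := (lift_term u^2) (at level 2, format "u ^3").

Definition van_form u v : formula L :=
  not_form (ex_form (ex_form
    (Eq (add_term (mul_term (Var 1) u^2) (mul_term (Var 0) v^2)) one_term))).

Lemma sat_van e u v f g : eval S e u = f -> eval S e v = g ->
  sat S e (van_form u v) = van f g.
Proof.
move=> <- <-; apply: sat_not; apply: sat_ex => a; apply: sat_ex => b.
by rewrite /= !eval_lift.
Qed.

Definition point_form u : formula L := and_form (van_form u u)
  (All (All (Imp (van_form (Var 1) u^2)
    (Imp (van_form (Var 0) u^2) (van_form (Var 1) (Var 0)))))).

Lemma sat_point e u k : eval S e u = k -> sat S e (point_form u) = is_point k.
Proof.
move=> <-; apply: sat_and; first exact: sat_van.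
apply: sat_all => f; apply: sat_all => l.
by apply: sat_imp; [|apply: sat_imp]; apply: sat_van; rewrite ?eval_lift.
Qed.

Definition le_at_form u v w : formula L :=
  ex_form (and_form (@Rel L tt (fun=> Var 0))
    (van_form (sub_term u^1 (mul_term (Var 0) v^1)) w^1)).

Lemma sat_le_at e u v w f g k :
  eval S e u = f -> eval S e v = g -> eval S e w = k ->
  sat S e (le_at_form u v w) = le_at f g k.
Proof.
move=> <- <- <-; apply: sat_ex => b; apply: sat_and => //.
by apply: sat_van; rewrite /= !eval_lift.
Qed.

Definition cluster_form u v w z : formula L :=
  All (All (Imp (not_form (van_form (Var 1) u^2)) (Imp (not_form (van_form (Var 0) u^2))
    (ex_form (and_form (point_form (Var 0)) (and_form (van_form w^3 (Var 0))
      (and_form (not_form (van_form u^3 (Var 0)))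
      (and_form (not_form (van_form (Var 2) (Var 0)))
        (le_at_form (sub_term v^3 (mul_term z^3 u^3)) (mul_term (Var 1) u^3) (Var 0)))))))))).

Lemma sat_cluster e u v w z k g s a :
  eval S e u = k -> eval S e v = g -> eval S e w = s -> eval S e z = a ->
  sat S e (cluster_form u v w z) = cluster k g s a.
Proof.
move=> <- <- <- <-; apply: sat_all => h; apply: sat_all => r.
apply: sat_imp; first by apply/sat_not/sat_van; rewrite ?eval_lift.
apply: sat_imp; first by apply/sat_not/sat_van; rewrite ?eval_lift.
apply: sat_ex => j; apply: sat_and; first exact: sat_point.
apply: sat_and; first by apply/sat_van; rewrite ?eval_lift.
apply: sat_and; first by apply/sat_not/sat_van; rewrite ?eval_lift.
apply: sat_and; first exact/sat_not/sat_van.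
by apply: sat_le_at; rewrite /= ?eval_lift.
Qed.

(** The free variable is [t]; the bound ones are, from the outside in, [k], [x], [g], [s], [c], [a],
    [b]. Just below the quantifier of [a], the indices 0 to 6 thus stand for [a], [c], [s], [g],
    [x], [k], [t]. *)
Definition geometric_progressions_form : formula L :=
  ex_form (and_form (point_form (Var 0)) (All (Imp (not_form (van_form (Var 0) (Var 1)))
    (ex_form (ex_form (ex_form (and_form (not_form (van_form (Var 0) (Var 4)))
      (and_form (cluster_form (Var 4) (Var 2) (Var 1) one_term)
        (All (Imp (cluster_form (Var 5) (Var 3) (Var 2) (Var 0))
          (and_form (le_at_form (Var 0) one_term (Var 5))
            (and_form (or_form (le_at_form (Var 0) (Var 4) (Var 5))
                        (cluster_form (Var 5) (Var 3) (Var 2) (mul_term (Var 6) (Var 0))))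
              (All (Imp (cluster_form (Var 6) (Var 4) (Var 3) (Var 0))
                (or_form (van_form (sub_term (Var 1) (Var 0)) (Var 6))
                  (le_at_form (Var 2) (sub_term (Var 1) (Var 0)) (Var 6))))))))))))))))).

Lemma sat_geometric_progressions e :
  sat S e geometric_progressions_form = geometric_progressions (e 0%N).
Proof.
apply: sat_ex => k; apply: sat_and; first exact: sat_point.
apply: sat_all => x; apply: sat_imp; first exact/sat_not/sat_van.
apply: sat_ex => g; apply: sat_ex => s; apply: sat_ex => c.
apply: sat_and; first exact/sat_not/sat_van.
apply: sat_and; first exact: sat_cluster.
apply: sat_all => a; apply: sat_imp; first exact: sat_cluster.
apply: sat_and; first exact: sat_le_at.
apply: sat_and; first by apply: sat_or; [exact: sat_le_at|exact: sat_cluster].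
apply: sat_all => b; apply: sat_imp; first exact: sat_cluster.
by apply: sat_or; [exact: sat_van|exact: sat_le_at].
Qed.

End PointsInRings.

(** * The meaning of these notions in [C(X)] *)

Section PointsInFunctionRings.
Variables (E : language) (M : field_expansion E) (n : nat) (X : definable_set M n).
Local Notation R := (cdfType X).
Implicit Types (f g h k s : R) (x y p : X).

Lemma van_ev f g : van f g <-> exists x, ev x f = 0 /\ ev x g = 0.
Proof.
split=> [h|[x [f0 g0]] [a [b /(congr1 (ev x))]]].
  apply: contrapT => nx; apply: h.
  have [|a [b [ab _]]] := @bezout_function _ _ _ _ f g; last by exists a, b.
  by move=> x f0 g0; apply: nx; exists x.
by rewrite !evE f0 g0 !mulr0 addr0 => /esym/eqP; rewrite oner_eq0.
Qed.

(** If [k] had two zeros, some coordinate would tell them apart; subtracting from it its two values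
    gives two functions that each meet the zeros of [k] but have no common zero. *)
Lemma point_ev k : is_point k <-> exists p, forall x, ev x k = 0 <-> x = p.
Proof.
split=> [[vkk kl]|[p kp]].
  have [p [kp _]] := (van_ev k k).1 vkk; exists p => x.
  split=> [kx|-> //]; apply: val_inj; apply/rowP => j.
  have [c Ec] := cdf_coord X j.
  have /van_ev[z []] : van (c - cstf X (val x ord0 j)) (c - cstf X (val p ord0 j)).
    by apply: kl; apply/van_ev; [exists x|exists p]; rewrite !evE ev_cst Ec subrr.
  rewrite !evE !ev_cst => /eqP; rewrite subr_eq0 => /eqP -> /eqP.
  by rewrite subr_eq0 => /eqP.
have vk f : van f k <-> ev p f = 0.
  by rewrite van_ev; split=> [[x [f0 /kp <-]]|f0]; [|exists p; split=> //; apply/kp].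
split; first by apply/vk/kp.
by move=> f l /vk f0 /vk l0; apply/van_ev; exists p.
Qed.

Section At.
Variables (k : R) (p : X) (kp : forall x, ev x k = 0 <-> x = p).

Lemma van_at f : van f k <-> ev p f = 0.
Proof.
by rewrite van_ev; split=> [[x [f0 /kp <-]]|f0]; [|exists p; split=> //; apply/kp].
Qed.

Lemma le_at_ev f g : le_at (@cdf_bounded _ _ _ X) f g k <-> abs_le (ev p f) (ev p g).
Proof.
split=> [[b [Bb /van_at]]|[a Oa h]].
  rewrite !evE => /eqP; rewrite subr_eq0 => /eqP ->; exists (ev p b); last exact: mulrC.
  exact: Bb.
(* Only the value at [p] matters, so a constant function can be the multiplier. *)
exists (cstf X a); split; first by move=> x; have := ev_cst a x; rewrite /ev => ->.
by apply/van_at; rewrite !evE ev_cst h mulrC subrr.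
Qed.

(** The estimate says that [g / k] is within [r] of [a] at [x], multiplied through by [k(x)]. *)
Definition cluster_value g s (a : M) : Prop :=
  forall r d : M, r != 0 -> d != 0 -> exists x, ball (val p) d (val x) /\
    (ev x k <> 0 /\ (ev x s = 0 /\ abs_le (ev x g - a * ev x k) (r * ev x k))).

End At.

(** Functions that do not vanish at [p] encode both neighborhoods, as the places where they stay
    nonzero, and precisions. Bump functions and constants show that this encoding is fine enough. *)
Lemma cluster_ev k p (kp : forall x, ev x k = 0 <-> x = p) g s a :
  cluster (@cdf_bounded _ _ _ X) k g s a <-> cluster_value k p g s (ev p a).
Proof.
split=> [h r d r0 d0|h b e].
  (* In the ring [a] is a function: the precision [t] leaves room for the error [a(x) - a(p)]. *)
  have [t t0 ht] := abs_sub r0; have [da da0 hda] := near_ev a p t0.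
  have [d' d'0 [d'd d'da]] := abs_le_min d0 da0.
  have [b [b1 hb]] := bump_function p d'0.
  have [||j [/point_ev[x jx]]] := h b (cstf X t).
  - by rewrite (van_at kp) b1; apply/eqP; exact: oner_neq0.
  - by rewrite (van_at kp) ev_cst; exact/eqP.
  rewrite !(van_at jx) (le_at_ev jx) !evE ev_cst => -[sx [kx [/hb bx gx]]].
  exists x; split; first exact: ball_subset bx.
  split=> //; split=> //.
  have ax := hda x (ball_subset d'da bx).
  have kx0 : ev x k != 0 by exact/eqP.
  have {gx} gx : abs_le (ev x g / ev x k - ev x a) t.
    apply: (@abs_le_mul2lI _ _ (ev x k)) => //.
    by rewrite mulrBr mulrCA divff // mulr1 [_ * ev x a]mulrC [_ * t]mulrC.
  have ax' : abs_le (- (ev x a - ev p a)) t by apply/abs_leN.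
  have := abs_le_mul2r (ev x k) (ht _ _ gx ax').
  by congr abs_le; field.
rewrite !(van_at kp) => /eqP b0 /eqP e0.
(* Near [p], |e| stays above |c|, so precision [c] suffices; [t] shares it between the quotient and
   the variation of [a]. *)
have [c c0 hc] := abs_lower e0; have [t t0 ht] := abs_sub c0.
have [db db0 hdb] := abs_lower b0.
have [d1 d10 h1] := near_ev b p db0; have [d2 d20 h2] := near_ev e p c0.
have [d3 d30 h3] := near_ev a p t0.
have [d4 d40 [d41 d42]] := abs_le_min d10 d20.
have [d d0 [dd4 dd3]] := abs_le_min d40 d30.
have [x [xd [kx [sx gx]]]] := h t d t0 d0.
have [j jx] := point_function x.
exists j; split; first by apply/point_ev; exists x.
rewrite !(van_at jx) (le_at_ev jx) !evE; split=> //; split=> //; split.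
  move=> bx; have := hdb _ (h1 x (ball_subset (abs_le_trans dd4 d41) xd)).
  by rewrite bx => /abs_le_eq0 db00; rewrite db00 eqxx in db0.
have kx0 : ev x k != 0 by exact/eqP.
have {gx} gx : abs_le (ev x g / ev x k - ev p a) t.
  apply: (@abs_le_mul2lI _ _ (ev x k)) => //.
  by rewrite mulrBr mulrCA divff // mulr1 [_ * ev p a]mulrC [_ * t]mulrC.
have ax := h3 x (ball_subset dd3 xd).
have ex := hc _ (h2 x (ball_subset (abs_le_trans dd4 d42) xd)).
have := abs_le_mul2r (ev x k) (abs_le_trans (ht _ _ gx ax) ex).
by congr abs_le; field.
Qed.

Lemma dpred_allI (I : finType) (P : I -> (nat -> M) -> Prop) :
  (forall j, dpred (P j)) -> dpred (fun e => forall j, P j e).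
Proof.
move=> dP; suff H : forall s : seq I, dpred (fun e => forall j, j \in s -> P j e).
  apply: dpred_ext (H (enum I)) => e.
  by split=> h j; [move=> _|apply: h; rewrite mem_enum].
elim=> [|j s IH].
  by apply: dpred_ext (dpred_atom M (Imp Bot Bot)) => e; split=> // _ j.
apply: dpred_ext (dpred_and (dP j) IH) => e; split=> [h|[hj hs] l].
  by split=> [|l ls]; apply: h; rewrite in_cons ?eqxx ?ls ?orbT.
by rewrite in_cons => /orP[/eqP ->|/hs].
Qed.

(** Makes the finiteness hypothesis on definable sets applicable to sets of cluster values. *)
Lemma dpred_cluster_value k p g s :
  dpred (fun e => cluster_value k p g s (e 0%N)).
Proof.
have dtot f : dterm (fun e => ftot (val f) (vget 0 n e)) := dfun_ev f.
have d0 := dterm_cst (0 : M).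
have dv j := dterm_var M j.
have dk := dtot k.
(* The vector comes first; the positions [n], [n + 1], [n + 2] after it hold the radius [d], the
   precision [r] and the value. *)
have dbody := dpred_and (definable_dpred (dsetP X)) (dpred_and
  (dpred_allI (fun j : 'I_n => dpred_not (dpred_abs_le (dv (n + 0)%N)
    (dterm_sub (dv j) (dterm_cst (val p ord0 j))))))
  (dpred_and (dpred_not (dpred_eq dk d0)) (dpred_and (dpred_eq (dtot s) d0)
    (dpred_abs_le (dterm_sub (dtot g) (dterm_mul (dv (n + 2)%N) dk))
      (dterm_mul (dv (n + 1)%N) dk))))).
have dq := dpred_imp (dpred_not (dpred_eq (dv 1%N) d0))
  (dpred_imp (dpred_not (dpred_eq (dv 0%N) d0)) (dpred_exv n dbody)).
apply: dpred_ext (dpred_all (dpred_all dq)) => e.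
have Ev (v : 'rV[M]_n) u : vget 0 n (vcons v u) = v.
  by apply/rowP => j; rewrite mxE vcons_lt.
have Eb (v : 'rV[M]_n) d u : ball (val p) d v <-> forall j : 'I_n,
    ~ abs_le d (vcons v u j - val p ord0 j).
  by split=> h j; have := h j; rewrite vcons_lt abs_lt_nle !mxE.
split=> h r d /eqP r0 /eqP dn0.
  have [x [bx [kx [sx gx]]]] := h r d r0 dn0; exists (val x).
  rewrite !Ev !vcons_ge !ftotE; split; first exact: set_XP.
  by split=> //; apply/Eb.
have [v] := h r d r0 dn0; rewrite !Ev !vcons_ge => -[Xv [/Eb bx]].
by rewrite -[v]/(val (SigSub (mem_set Xv) : X)) !ftotE; exists (SigSub (mem_set Xv)).
Qed.

End PointsInFunctionRings.

(** * The two structures *)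

Section Refutation.
Variables (E : language) (M : field_expansion E).

(** Uniform separation gives discreteness and also closedness, since at most one element can be very
    close to a given point outside the set. *)
Lemma separated_finite (A : M -> Prop) (c : M) :
  closed_bounded_discrete_finite M -> dpred (fun e => A (e 0%N)) ->
  (forall a, A a -> abs_le a 1) -> c != 0 ->
  (forall a b, A a -> A b -> a = b \/ abs_le c (a - b)) ->
  finite_set [set v : 'rV[M]_1 | A (v ord0 ord0)].
Proof.
move=> finM dA bA c0 sA; apply: finM.
- have := dpred_definable 1 dA; congr definable.
  by apply/seteqP; split=> v /=; rewrite (vcons_lt v _ ord0).
- move=> v /= Av; set y := v ord0 ord0 in Av.
  have [r r0 hr] := abs_shrink c0; have [t t0 ht] := abs_sub r0.
  (* The ball of radius [a - y] excludes [a] itself, and any other element in it would be closer to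
     [a] than [c]. *)
  have [[a [Aa ay]]|na] := pselect (exists a, A a /\ abs_le (a - y) t).
    exists (a - y); first by rewrite subr_eq0; apply: contra_not_neq Av => <-.
    move=> w /(_ ord0); rewrite !mxE -/y => wy Aw.
    have [wa|] := sA _ _ Aw Aa; first by apply: (@abs_lt_irr _ _ (a - y)); rewrite -{1}wa.
    have := hr _ (ht _ _ (abs_le_trans wy.1 ay) ay).
    by rewrite opprB addrA subrK => -[].
  exists t => // w /(_ ord0); rewrite !mxE => -[wy _] Aw.
  by apply: na; exists (w ord0 ord0).
- by exists 1 => v Av j; rewrite [j]ord1; exact: bA.
- move=> v Av; split=> //; exists c => // w [Aw /(_ ord0)]; rewrite !mxE => -[_ wv].
  apply/rowP => j; rewrite [j]ord1.
  by case: (sA _ _ Aw Av).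
Qed.

(** Cancelling in an equality of two different powers leaves [1 = t^(m+1)], which forces |1| <=
    |t|. *)
Lemma powers_inj (t : M) : t != 0 -> abs_lt t 1 -> injective (fun j : nat => t ^+ j).
Proof.
move=> t0 t1.
have H i m : t ^+ i <> t ^+ (i + m.+1).
  rewrite exprD -[LHS]mulr1 => /(mulfI (expf_neq0 i t0)) e.
  have tm : abs_le (t ^+ m) 1.
    elim: m {e} => [|m IH]; first exact: abs_le_refl.
    by rewrite exprS -[1]mulr1; apply: abs_le_mul => //; case: t1.
  case: t1 => _; apply; rewrite e exprS -[X in abs_le _ X]mulr1.
  exact: abs_le_mul2l.
move=> i j /= ij; case: (ltngtP i j) => // h; exfalso.
  by apply: (H i (j - i.+1)%N); rewrite addnS -addSn subnKC.
by apply: (H j (i - j.+1)%N); rewrite addnS -addSn subnKC.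
Qed.

Lemma no_geometric_progressions n (X : definable_set M n) (t z : M) :
  closed_bounded_discrete_finite M -> t != 0 -> abs_lt t 1 -> z != 0 ->
  (forall j : nat, ~ abs_le (t ^+ j) z) ->
  ~ geometric_progressions (@cdf_bounded _ _ _ X) (cstf X t).
Proof.
move=> finM t0 t1 z0 tz [k [/point_ev[p kp] /(_ (cstf X z))]].
rewrite (van_at kp) ev_cst => -[|g [s [c]]]; first exact/eqP.
rewrite (van_at kp) (cluster_ev kp) ev1 => -[/eqP c0 [A1 hA]].
pose A := cluster_value k p g s.
(* Constant functions turn the hypothesis on elements of the ring into one on their values at
   [p]. *)
have {}hA a : A a -> abs_le a 1 /\ ((abs_le a z \/ A (t * a)) /\
    forall b, A b -> a - b = 0 \/ abs_le (ev p c) (a - b)).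
  move=> Aa; have := hA (cstf X a); rewrite (cluster_ev kp) ev_cst => /(_ Aa).
  rewrite !(le_at_ev kp) (cluster_ev kp) !evE !ev_cst => -[h1 [h2 h3]].
  split=> //; split=> // b Ab; have := h3 (cstf X b).
  by rewrite (cluster_ev kp) (van_at kp) (le_at_ev kp) !evE !ev_cst; apply.
(* No power is as small as [z], so the progression can never stop. *)
have At (j : nat) : A (t ^+ j).
  elim: j => [|j /hA[_ [[/tz//|]]]]; first by rewrite expr0.
  by rewrite exprS.
have fA : finite_set [set v : 'rV[M]_1 | A (v ord0 ord0)].
  apply: (@separated_finite A (ev p c)) => //; first exact: dpred_cluster_value.
    by move=> a /hA[].
  move=> a b /hA[_ [_ h]] /h[/eqP|]; last by right.
  by rewrite subr_eq0 => /eqP; left.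
apply: infinite_nat; pose F (j : nat) : 'rV[M]_1 := const_mx (t ^+ j).
have -> : [set: nat] = F @^-1` [set v : 'rV[M]_1 | A (v ord0 ord0)].
  by apply/seteqP; split=> j //= _; rewrite mxE; exact: At.
apply: finite_preimage fA => i j _ _ /rowP/(_ ord0); rewrite !mxE.
exact: powers_inj.
Qed.

End Refutation.

(** * Finite sets of powers as cluster sets of germs *)

Section Realization.
Variables (E : language) (M : field_expansion E) (n : nat) (X : definable_set M n).
Local Notation R := (cdfType X).
Implicit Types (x y p : X).

(** Balls are open, one coordinate at a time: a strict inequality makes the squares differ, and the
    comparison is then locally constant. *)
Lemma near_ball (Y : set 'rV[M]_n) p (r : M) v : r != 0 -> ball (val p) r v ->
  near_at Y v (ball (val p) r).
Proof.
move=> r0 pv.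
apply: (@near_all _ _ _ Y 'I_n v
  (fun j w => abs_lt ((w - val p) ord0 j) r)) => j.
pose F (w : 'rV[M]_n) := w ord0 j - val p ord0 j.
have cF : cont_at Y F v by apply: cont_sub; [exact: cont_coord|exact: cont_cst].
have Fv : abs_lt (F v) r by have := pv j; rewrite !mxE.
have Fr : F v ^+ 2 != r ^+ 2.
  by apply/eqP => e; case: Fv => _; apply; exact: abs_le_sqr.
apply: near_sub (abs_le_stable cF (cont_cst Y r v) Fr) _ => w _ h.
by rewrite /= !mxE abs_lt_nle -/(F w) h -abs_lt_nle.
Qed.

Lemma near_neq (Y : set 'rV[M]_n) (u v : 'rV[M]_n) : v <> u ->
  near_at Y v (fun w => w <> u).
Proof.
move=> /eqP; rewrite -subr_eq0 => /rV0Pn[j]; rewrite !mxE => d0.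
exists (v ord0 j - u ord0 j) => // w _ /(_ j) + wu; rewrite wu !mxE.
by move=> /abs_ltB/abs_lt_irr.
Qed.

Lemma near_self (Y : set 'rV[M]_n) v (A : 'rV[M]_n -> Prop) : Y v -> near_at Y v A -> A v.
Proof.
move=> Yv [d d0 h]; apply: h => // j; rewrite !mxE subrr; apply/abs_lt_nle.
by move=> /abs_le_eq0/eqP; exact/negP.
Qed.

(** A cut-off: functions given only on a neighborhood of [p] become elements of [C(X)] after
    multiplication by one common bump [h]. *)
Lemma extend_by_zero p (r : M) : r != 0 -> exists h : R,
  [/\ ev p h = 1, forall x, ev x h <> 0 -> ball (val p) r (val x) &
   forall F, dfun F ->
     (forall x, ball (val p) r (val x) ->
       cont_at X (fun v => ftot (val h) v * F v) (val x)) ->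
     exists f : R, forall x, ev x f = ev x h * F (val x)].
Proof.
(* The bump lives in the ball of radius [t] around [p], and [t] is so small that the ball of radius
   [t] around any point outside the ball of radius [r] misses it. *)
move=> r0; have [s s0 hs] := abs_shrink r0; have [t t0 ht] := abs_sub s0.
have [h [h1 hb]] := bump_function p t0; exists h.
have hr x : ev x h <> 0 -> ball (val p) r (val x).
  move=> /hb xp j; apply: hs; rewrite -[X in abs_le X _]subr0; apply: ht (abs_le0 _).
  by case: (xp j).
split=> // F dF cF.
have [||f Ef] := @cdf_make _ _ _ X (fun v => ftot (val h) v * F v).
- by apply: dterm_mul => //; exact: dfun_ev.
- move=> x; have [/cF //|nx] := pselect (ball (val p) r (val x)).
  have zero y : ball (val x) t (val y) -> ev y h = 0.
    move=> xy; apply: contrapT => /hb py; apply: nx => j; apply: hs.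
    have := ht _ _ (py j).1 (xy j).1; rewrite !mxE.
    by congr abs_le; ring.
  apply: (cont_local _ _ (cont_cst X 0 (val x))).
    exists t => // v Xv xv; have := zero (SigSub (mem_set Xv)) xv.
    by rewrite /ev -ftotE /= => ->; rewrite mul0r.
  have -> : ftot (val h) (val x) = 0 by rewrite ftotE; apply: contrapT => /hr.
  by rewrite mul0r.
by exists f => x; rewrite Ef ftotE.
Qed.

Lemma finite_lower (I : finType) (F : I -> M) :
  exists2 c, c != 0 & forall j, F j = 0 \/ abs_le c (F j).
Proof.
suff [c c0 h] : exists2 c, c != 0 & forall j, j \in enum I -> F j = 0 \/ abs_le c (F j).
  by exists c => // j; apply: h; rewrite mem_enum.
elim: (enum I) => [|j s [c c0 h]]; first by exists 1; rewrite ?oner_neq0.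
have [Fj|Fj] := eqVneq (F j) 0.
  by exists c => // l; rewrite in_cons => /orP[/eqP ->|/h //]; left.
have [d d0 [dc dF]] := abs_le_min c0 Fj; exists d => // l.
rewrite in_cons => /orP[/eqP ->|/h[|cl]]; [by right|by left|right].
exact: abs_le_trans cl.
Qed.

Lemma germs_geometric_progressions p (t : M) :
  arbitrarily_many_germs X (val p) -> abs_le t 1 ->
  (forall z, z != 0 -> exists j : nat, abs_le (t ^+ j) z) ->
  geometric_progressions (@cdf_bounded _ _ _ X) (cstf X t).
Proof.
move=> germs t1 small; have [k kp] := point_function p.
exists k; split; first by apply/point_ev; exists p.
move=> z; rewrite (van_at kp) => /eqP z0; have [N zN] := small _ z0.
(* [N + 1] germs would not do for [N = 0]: a condition on [delta_i] on [S_i]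
   is only stated for [k >= 2] germs. *)
have [U [_ [UX [r r0 rU]] [s0 cs0 [dl cdl [_ germ sep bd]]]]] := germs N.+2 isT.
have [h [h1 hb hF]] := extend_by_zero p r0.
have XU x : ball (val p) r (val x) -> U (val x).
  by move=> px; apply: rU; split=> //; exact: set_XP.
have nearU x : ball (val p) r (val x) -> near_at X (val x) U.
  by move=> /(near_ball X r0)/near_sub; apply=> y Xy py; exact: rU.
have /choice[s Es] j : exists f : R, forall x, ev x f = ev x h * ftot (s0 j) (val x).
  have [cs ds] := cs0 j; apply: hF; first exact: dfun_ftot.
  move=> x px; apply: cont_mul; first exact: cont_ev.
  exact: (@cont_ftot _ _ _ _ X (s0 j) (SigSub (mem_set (XU x px)))) (nearU x px).
have /choice[g Eg] j : exists f : R, forall x,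
    ev x f = ev x h * (ev x k * ftot (dl j) (val x)).
  have [cd dd] := cdl j.
  pose F v := ftot (val k) v * ftot (dl j) v.
  have [f Ef] : exists f : R, forall x, ev x f = ev x h * F (val x).
    apply: hF; first by apply: dterm_mul; [exact: dfun_ev|exact: dfun_ftot].
    move=> x px; apply: cont_mul; first exact: cont_ev.
    have [xp|xp] := eqVneq x p; last first.
      have xp' : val x <> val p by move=> /val_inj/eqP; exact/negP.
      have nD : near_at X (val x) (U `\ val p).
        exact: near_and2 (nearU x px) (near_neq X xp') _.
      have Dx := near_self (set_XP x) nD.
      apply: cont_mul; first exact: cont_ev.
      exact: (@cont_ftot _ _ _ _ X (dl j) (SigSub (mem_set Dx))).
    (* At [p], where [dl j] is undefined and its extension is 0, boundedness gives |k dl_j| <= |b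
       k|, and [k] tends to 0. *)
    have [b hbd] := bd j; rewrite xp => q q0.
    have [w w0 hw] := abs_scale b q0.
    apply: near_sub (cont_ev k p w0) _ => v _.
    have kp0 : ftot (val k) (val p) = 0 by rewrite ftotE; apply/kp.
    rewrite /F kp0 mul0r !subr0 => /hw; apply: abs_le_trans; rewrite mulrC.
    apply: abs_le_mul2r; have [Dv|nDv] := pselect ((U `\ val p) v).
      rewrite -[v]/(val (SigSub (mem_set Dv) : (U `\ val p : set _))) ftotE.
      exact: hbd.
    by rewrite ftot_out //; exact: abs_le0.
  by exists f => x; rewrite Ef /F ftotE.
(* Over the germ [j] only the term [j] of [G] survives, so [G / k = h t^j] there, which tends to
   [t^j] at [p]. Close to [p], the other zeros of [S] all lie on germs. *)
pose S := \prod_(j < N.+2) s j.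
pose G := \sum_(j < N.+2) cstf X (t ^+ j) * g j.
pose onS j (x : X) := (zero_set (s0 j) `\ val p) (val x).
have GonS j x : onS j x -> ev x G = ev x h * t ^+ j * ev x k.
  move=> Sx; have [[u Zu ux] xp] := Sx.
  have Dx : (U `\ val p) (val x) by split=> //; rewrite -ux; exact: set_valP.
  have dlE l : ftot (dl l) (val x) = (l == j)%:R.
    rewrite -[val x]/(val (SigSub (mem_set Dx) : (U `\ val p : set _))) ftotE.
    have [->|lj] := eqVneq l j; last by apply: (sep l j lj).2.
    by apply: (sep j (lift j ord0) (neq_lift _ _)).1.
  rewrite /G ev_sum (bigD1 j) //= big1 => [|l lj].
    by rewrite !evE ev_cst Eg dlE eqxx mulr1 addr0 mulrCA mulrA.
  by rewrite !evE Eg dlE (negbTE lj) !mulr0.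
have Szero x : ev x k <> 0 -> ev x h <> 0 -> ev x S = 0 -> exists j, onS j x.
  move=> /(contra_not (kp x).2) xp hx /eqP; rewrite ev_prod => /prodf_eq0[j _].
  rewrite Es mulf_eq0 => /orP[/eqP//|/eqP sx]; exists j.
  have Ux := XU x (hb x hx); split; last by move=> /val_inj.
  by exists (SigSub (mem_set Ux)) => //; rewrite /= -ftotE.
have tj1 (j : nat) : abs_le (t ^+ j) 1.
  elim: j => [|j IH]; first exact: abs_le_refl.
  by rewrite exprS -[1]mulr1; exact: abs_le_mul.
have clP a : cluster_value k p G S a <-> exists j : 'I_N.+2, a = t ^+ j.
  split=> [cl|[j ->] q d q0 d0].
    (* If [a] is none of the powers, [c] is a lower bound for its distance to all of them, against
       the value of [G / k] on a germ close to [p]. *)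
    have [c c0 hc] := finite_lower (fun j : 'I_N.+2 => t ^+ j - a).
    apply: contrapT => na.
    have {}hc (j : 'I_N.+2) : abs_le c (t ^+ j - a).
      by case: (hc j) => // /eqP; rewrite subr_eq0 => /eqP ta; case: na; exists j.
    have [q q0 hq] := abs_shrink c0; have [w w0 hw] := abs_sub q0.
    (* [b] keeps [h] away from 0 near [p], so that a zero of [S] there lies on a germ; [w] makes
       [h t^j] close to [t^j]. *)
    have [b b0 hb0] := abs_lower (oner_neq0 M).
    have [bw bw0 [bwb bww]] := abs_le_min b0 w0.
    have [d d0 hd] := near_ev h p bw0.
    have [x [/hd xd [kx [Sx Gx]]]] := cl w d w0 d0.
    rewrite h1 in xd.
    have hx : ev x h <> 0.
      move=> hx; have := hb0 _ (abs_le_trans xd bwb).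
      by rewrite hx => /abs_le_eq0/eqP; exact/negP.
    have [j Sj] := Szero x kx hx Sx.
    have {Gx} Gx : abs_le (ev x h * t ^+ j - a) w.
      apply: (@abs_le_mul2lI _ _ (ev x k)); first exact/eqP.
      rewrite [_ * w]mulrC; move: Gx; rewrite (GonS j x Sj).
      by congr abs_le; ring.
    have {xd} xd : abs_le (ev x h * t ^+ j - t ^+ j) w.
      have -> : ev x h * t ^+ j - t ^+ j = (ev x h - 1) * t ^+ j by ring.
      by rewrite -[w]mulr1; apply: abs_le_mul => //; exact: abs_le_trans bww.
    have [_] := hq _ (hw _ _ Gx xd); apply; apply: abs_le_trans (hc j) _.
    have -> : ev x h * t ^+ j - a - (ev x h * t ^+ j - t ^+ j) = t ^+ j - a by ring.
    exact: abs_le_refl.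
  have [d' d'0 hd'] := near_ev h p q0; have [e e0 [ed ed']] := abs_le_min d0 d'0.
  (* Since [p] is not isolated among the zeros of the germ [j], that germ has points different from
     [p] in every ball. *)
  have [Zp niso] := germ j.
  have [v [Zv pv] vp] : exists2 v, (zero_set (s0 j) `&` ball (val p) e) v & v <> val p.
    apply: contrapT => nv; apply: niso; split=> //; exists e => // v Zv.
    by apply: contrapT => vp; apply: nv; exists v.
  have Xv : dset X v by have [u _ <-] := Zv; apply: UX; exact: set_valP.
  pose x : X := SigSub (mem_set Xv).
  have Sx : onS j x by [].
  have sx : ftot (s0 j) (val x) = 0 by have [u Zu uv] := Zv; rewrite /= -uv ftotE.
  exists x; split; first exact: ball_subset ed _ pv.
  split; first by move=> /kp xp; apply: vp; rewrite -xp.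
  split; first by rewrite ev_prod (bigD1 j) //= Es sx mulr0 mul0r.
  rewrite (GonS j x Sx) -mulrBl; apply: abs_le_mul2r.
  have -> : ev x h * t ^+ j - t ^+ j = (ev x h - ev p h) * t ^+ j by rewrite h1; ring.
  rewrite -[q]mulr1; apply: abs_le_mul => //; apply: hd'.
  exact: ball_subset ed' _ pv.
have [c c0 hc] := finite_lower (fun ij : 'I_N.+2 * 'I_N.+2 => t ^+ ij.1 - t ^+ ij.2).
exists G, S, (cstf X c); rewrite (van_at kp) ev_cst; split; first exact/eqP.
rewrite (cluster_ev kp) ev1 clP; split; first by exists ord0; rewrite expr0.
move=> a; rewrite (cluster_ev kp) clP => -[j aj].
rewrite !(le_at_ev kp) (cluster_ev kp) clP !evE ev_cst aj; split; first exact: tj1.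
split.
  (* Only the last exponent has no successor in the set, and its power is already at most |t^N| <=
     |z|. *)
  have [jN|Nj] := ltnP j N.+1.
    by right; exists (Ordinal (jN : j.+1 < N.+2)%N); rewrite /= exprS.
  left; apply: abs_le_trans zN; rewrite -(subnKC (ltnW Nj)) exprD.
  by rewrite -[X in abs_le _ X]mulr1; apply: abs_le_mul2l.
move=> b; rewrite (cluster_ev kp) clP => -[l bl].
rewrite (van_at kp) (le_at_ev kp) !evE ev_cst aj bl.
exact: (hc (j, l)).
Qed.

End Realization.

(** * Powers and the archimedean condition *)

Section Archimedean.
Variables (E : language) (M : field_expansion E).
Implicit Types (t u z : M).

Lemma abs_ge1_exp u (j : nat) : abs_le 1 u -> abs_le 1 (u ^+ j).
Proof.
move=> u1; elim: j => [|j IH]; first exact: abs_le_refl.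
by rewrite exprS -[1]mulr1; exact: abs_le_mul.
Qed.

Lemma abs_inv_ge1 t : t != 0 -> abs_le t 1 -> abs_le 1 t^-1.
Proof. by move=> t0 /(abs_le_mul2l t^-1); rewrite mulVf // mulr1. Qed.

Lemma archimedean_inv t : archimedean t -> archimedean t^-1.
Proof.
by move=> ht z /ht[k tk]; exists (- k); rewrite exprz_inv opprK.
Qed.

Lemma archimedean_nat t : t != 0 -> abs_lt t 1 -> archimedean t ->
  forall z, z != 0 -> exists j : nat, abs_le (t ^+ j) z.
Proof.
move=> t0 [t1 _] ht z /ht[[j|j] tz]; first by exists j.
(* A negative power of [t] is at least 1 in absolute value, so exponent 0 does as well. *)
exists 0%N; apply: abs_le_trans tz; rewrite expr0 NegzE -exprz_inv.
exact/abs_ge1_exp/abs_inv_ge1.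
Qed.

(** Otherwise |t| = 1, and no power of [t] gets below 1, although nonzero elements below 1 exist. *)
Lemma archimedean_lt1 t : t != 0 -> archimedean t -> abs_lt t 1 \/ abs_lt t^-1 1.
Proof.
move=> t0 ht; rewrite !abs_lt_nle -not_andE => -[t1 t1'].
have [s s0 hs] := abs_shrink (oner_neq0 M); have [k /hs[_]] := ht s s0; apply.
by case: k => j; rewrite ?NegzE -?exprz_inv; exact: abs_ge1_exp.
Qed.

End Archimedean.

(** * Transfer along the elementary extension *)

Section Transfer.
Variables (E : language) (K K' : field_expansion E) (i : K -> K').
Variable hi : elementary_extension i.

Lemma elementary_neq0 (t : K) : t != 0 -> i t != 0.
Proof.
move=> /eqP t0; apply/eqP.
apply: (@elementary_uniform _ _ _ _ (fun M e => ~ (e 0%N = 0)) (fun=> t) hi) t0.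
by apply: uniform_not; apply: uniform_eq (uniform_zero E); exact: uniform_var.
Qed.

Lemma elementary_inv (t : K) : t != 0 -> i t^-1 = (i t)^-1.
Proof.
move=> t0; have it0 := elementary_neq0 t0; apply: (mulfI it0); rewrite divff //.
apply: (@elementary_uniform _ _ _ _ (fun M e => e 0%N * e 1%N = 1)
  (fun k => if k is 0 then t else t^-1) hi); last by rewrite divff.
apply: uniform_eq (uniform_one E).
by apply: uniform_mul; exact: uniform_var.
Qed.

Lemma elementary_abs_lt1 (t : K) : abs_lt t 1 -> abs_lt (i t) 1.
Proof.
apply: (@elementary_uniform _ _ _ _ (fun M e => abs_lt (e 0%N) 1) (fun=> t) hi).
by apply: uniform_abs_lt (uniform_one E); exact: uniform_var.
Qed.

(** That every point of the graph has last coordinate [t] is first-order, with [t] as a parameter,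
    hence passes to the graph in [K']. *)
Lemma natural_embedding_cst n (X : definable_set K n) (X' : definable_set K' n)
    (hX : same_formula i X X') (t : K) :
  natural_embedding hi hX (cstf X t) = cstf X' (i t).
Proof.
rewrite /natural_embedding; case: cid => f /= [q [b [fq f'q]]].
pose P (M : field_expansion E) (c : nat -> M) :=
  forall v : 'rV[M]_(n + 1), defined_by q (odds c) v -> lastc v = evens c 0%N.
have uP : uniform P.
  apply: uniform_allv; apply: uniform_imp.
    apply: uniform_defined; first exact: uniform_vget.
    by exists (fun k => n + 1 + k.*2.+1)%N.
  apply: (@uniform_eq _ (fun M e => lastc (vget 0 (n + 1) e))
    (fun M e => e (n + 1 + 0)%N)); last exact: uniform_var.
  by apply: uniform_coord; exact: uniform_vget.
have Pc : P K (interleave (fun=> t) b).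
  move=> v; rewrite odds_interleave evens_interleave -fq => /graphP[x _ <-].
  exact: ev_cst.
apply: ev_inj => x; rewrite ev_cst.
have := elementary_uniform hi uP Pc => /(_ (row_mx (val x) (const_mx (ev x f)))).
have -> : odds (i \o interleave (fun=> t) b) = i \o b.
  by rewrite -{2}(odds_interleave (fun=> t) b).
rewrite -f'q => /(_ _); rewrite /lastc row_mxEr mxE; apply.
by exists x.
Qed.

End Transfer.

Theorem corollary5p7 (E : language) (K K' : field_expansion E) (i : K -> K')
    (hi : elementary_extension i)
    (hK : closed_bounded_discrete_finite K)
    (hK' : closed_bounded_discrete_finite K')
    (m : nat) (X : definable_set K m) (X' : definable_set K' m)
    (hX : same_formula i X X')
    (p0 : 'rV[K]_m) (hp0 : dset X p0)
    (hgerms : arbitrarily_many_germs X p0)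
    (tau : K) (htau : tau != 0)
    (harch : archimedean tau) (hnarch : ~ archimedean (i tau)) :
  ~ elementary_embedding (cdf_structure X) (cdf_structure X')
      (natural_embedding hi hX).
Proof.
move=> emb.
(* Both hypotheses on powers are invariant under replacing [tau] by its inverse, and |tau| = 1 is
   impossible. *)
wlog t1 : tau htau harch hnarch / abs_lt tau 1.
  move=> main; case: (archimedean_lt1 htau harch) => [/main|]; first exact.
  apply: main; rewrite ?invr_eq0 //; first exact: archimedean_inv.
  by rewrite (elementary_inv hi htau) => /archimedean_inv; rewrite invrK.
have [z [z0 hz]] : exists z : K', z != 0 /\ forall j : nat, ~ abs_le (i tau ^+ j) z.
  apply: contrapT => nz; apply: hnarch => z z0; apply: contrapT => nk.
  by apply: nz; exists z; split=> // j tz; apply: nk; exists j.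
pose p : X := SigSub (mem_set hp0).
(* At the constant function [tau] the formula holds in [C(X)], whereas its image, the constant
   [i tau], does not satisfy it in [C(X')]. *)
have := emb (geometric_progressions_form) (fun=> cstf X tau).
rewrite !sat_geometric_progressions /= natural_embedding_cst => -[+ _].
have small := archimedean_nat htau t1 harch.
move=> /(_ (@germs_geometric_progressions _ _ _ X p tau hgerms t1.1 small)).
apply: no_geometric_progressions hz => //; first exact: elementary_neq0 htau.
exact: elementary_abs_lt1.
Qed.
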